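(* Let $E\subset\mathbb{R}^N$ be open, $T>0$, $E_T=E\times(0,T]$, and let $u$ be a non-negative, local, weak solution in $E_T$ to $$u\in C_{\mathrm{loc}}\big(0,T;L^2_{\mathrm{loc}}(E)\big),\qquad \ln u\in L^2_{\mathrm{loc}}\big(0,T;W^{1,2}_{\mathrm{loc}}(E)\big),\qquad u_t-\Delta\ln u=0\ \text{ weakly in } E_T,$$ satisfying in addition $$u\in L^r_{\mathrm{loc}}(E_T)\ \text{ for some } r>\max\{1;\tfrac N2\},\qquad \ln u\in L^\infty_{\mathrm{loc}}\big(0,T;L^p_{\mathrm{loc}}(E)\big)\ \text{ for some } p\ge 2.$$ There exists a positive constant $\gamma$ depending only on $N,r,p$ and on the quantities $\Lambda_1$ and $\Lambda_2$ (defined in the context, relative to the cylinder under consideration) such that for all cylinders $K_{2\rho}(y)\times[s,t]\subset E_T$ there holds $$\sup_{s<\tau<t}\int_{K_\rho(y)}u(x,\tau)\,dx\le\gamma\left(\inf_{s<\tau<t}\int_{K_{2\rho}(y)}u(x,\tau)\,dx+\frac{t-s}{\rho^{\lambda}}\right),\qquad\text{where }\lambda=2-N.$$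
   Context: For $\rho>0$ and $y\in\mathbb{R}^N$, $K_\rho(y)$ is the cube in $\mathbb{R}^N$ centered at $y$ with edge $\rho$. The symbol $⨍$ is written here as $\frac1{|K|}\int_K$, the integral average. ''Weakly in $E_T$'' is the standard local weak formulation: for every compact $\mathcal K\subset E$, every $[t_1,t_2]\subset(0,T]$ and every test function $\varphi\in W^{1,2}_{\mathrm{loc}}(0,T;L^2(\mathcal K))\cap L^2_{\mathrm{loc}}(0,T;W^{1,2}_0(\mathcal K))$, $$\int_{\mathcal K}u\varphi\,dx\Big|_{t_1}^{t_2}+\int_{t_1}^{t_2}\int_{\mathcal K}\big[-u\varphi_t+D\ln u\cdot D\varphi\big]\,dx\,d\tau=0 .$$ For a cylinder $K_{2\rho}(y)\times[s,t]\subset E_T$, $0<s<t\le T$, set $$M=\operatorname*{ess\,sup}_{K_{2\rho}(y)\times(s,t]}u,\qquad \Lambda_j=\operatorname*{ess\,sup}_{s\le\tau\le t}\Big(\frac1{|K_{2\rho}(y)|}\int_{K_{2\rho}(y)}\Big|\ln\frac{u(x,\tau)}{M}\Big|^{j}dx\Big)^{1/j},\quad j=1,2.$$ Under the stated integrability hypotheses $u$ is locally bounded in $E_T$, and $M,\Lambda_1,\Lambda_2$ are understood to be finite for the cylinders considered. The dependence of $\gamma$ on the cylinder and on $u$ is only through the numbers $\Lambda_1,\Lambda_2$. *)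

(* Defs.v *)
From HB Require Import structures.
From mathcomp Require Import all_boot all_order all_algebra.
From mathcomp Require Import all_classical all_reals all_analysis.
From mathcomp Require Import ess_sup_inf.

Set Implicit Arguments.
Unset Strict Implicit.
Unset Printing Implicit Defensive.
Import Order.TTheory GRing.Theory Num.Theory.
Import numFieldNormedType.Exports.
Local Open Scope classical_set_scope.
Local Open Scope ring_scope.

(* R^n carries the product of the Borel sigma-algebras of the coordinates. *)
Section measurable_rV.
Context {R : realType} (n : nat).

Definition rV_coord (i : 'I_n) (v : 'rV[R]_n) : R := v ord0 i.

Let rV_set0 : g_sigma_preimage rV_coord set0.
Proof. exact: sigma_algebra0. Qed.

Let rV_setC A : g_sigma_preimage rV_coord A -> g_sigma_preimage rV_coord (~` A).
Proof. exact: sigma_algebraC. Qed.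

Let rV_bigcup (F : _^nat) : (forall i, g_sigma_preimage rV_coord (F i)) ->
  g_sigma_preimage rV_coord (\bigcup_i (F i)).
Proof. exact: sigma_algebra_bigcup. Qed.

HB.instance Definition _ := @isMeasurable.Build default_measure_display
  'rV[R]_n (g_sigma_preimage rV_coord) rV_set0 rV_setC rV_bigcup.

Lemma measurable_rV_coord i : measurable_fun [set: 'rV[R]_n] (rV_coord i).
Proof.
move=> _ Y mY; rewrite setTI; apply: sub_sigma_algebra => /=.
rewrite -bigcup_seq/=; exists i => /=; first by rewrite mem_index_enum.
by exists Y => //; rewrite setTI.
Qed.

Lemma measurable_fun_rVP d (T : measurableType d) (f : T -> 'rV[R]_n) :
  (forall i, measurable_fun [set: T] (rV_coord i \o f)) ->
  measurable_fun [set: T] f.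
Proof.
move=> mf.
have pre : g_sigma_preimage (fun i => rV_coord i \o f) `<=` measurable.
  apply: smallest_sub; first exact: sigma_algebra_measurable.
  rewrite -bigcup_seq/=; apply: bigcup_sub => i _.
  by move=> A [B mB <-]; exact: mf.
by move: pre; rewrite g_sigma_preimage_comp => pre _ A mA; apply: pre; exists A.
Qed.

End measurable_rV.

Section lebesgue_measure_step.
Context {R : realType} (n : nat).
Local Open Scope ereal_scope.

Definition rV_cons (z : measurableTypeR R * 'rV[R]_n) : 'rV[R]_n.+1 :=
  (\row_i oapp (fun j => z.2 ord0 j) z.1 (unlift ord0 i))%R.

Definition rV_uncons (v : 'rV[R]_n.+1) : measurableTypeR R * 'rV[R]_n :=
  (v ord0 ord0, \row_j v ord0 (lift ord0 j))%R.

Lemma rV_consK : cancel rV_cons rV_uncons.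
Proof.
move=> [x v]; rewrite /rV_uncons /rV_cons; congr pair.
  by rewrite mxE unlift_none.
by apply/rowP => j; rewrite !mxE liftK.
Qed.

Lemma measurable_rV_cons : measurable_fun setT rV_cons.
Proof.
apply: measurable_fun_rVP => i.
have [j ->|->] := unliftP ord0 i.
  rewrite (_ : _ \o _ = rV_coord j \o snd); last first.
    by apply/funext => z /=; rewrite /rV_coord mxE liftK.
  apply: measurableT_comp; first exact: measurable_rV_coord.
  exact: measurable_snd.
rewrite (_ : _ \o _ = fst); first exact: measurable_fst.
by apply/funext => z /=; rewrite /rV_coord mxE unlift_none.
Qed.

Lemma measurable_rV_uncons : measurable_fun setT rV_uncons.
Proof.
apply/measurable_fun_pairP; split; first exact: (measurable_rV_coord ord0).
apply: measurable_fun_rVP => j.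
rewrite (_ : _ \o _ = rV_coord (lift ord0 j)); first exact: measurable_rV_coord.
by apply/funext => v /=; rewrite /rV_coord mxE.
Qed.

Variable mu : {sigma_finite_measure set 'rV[R]_n -> \bar R}.

Definition lebesgue_step (A : set 'rV[R]_n.+1) : \bar R :=
  (lebesgue_measure \x mu) (rV_cons @^-1` A).

Let step0 : lebesgue_step set0 = 0.
Proof. by rewrite /lebesgue_step preimage_set0 measure0. Qed.

Let step_ge0 A : 0 <= lebesgue_step A.
Proof. exact: measure_ge0. Qed.

Let step_sigma_additive : semi_sigma_additive lebesgue_step.
Proof.
have mcons A : measurable A -> measurable (rV_cons @^-1` A).
  by move=> mA; rewrite -[X in measurable X]setTI; exact: measurable_rV_cons.
move=> F mF tF mUF; rewrite /lebesgue_step preimage_bigcup.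
apply: measure_semi_sigma_additive.
- by move=> k; exact: mcons.
- apply/trivIsetP => /= i j _ _ ij; rewrite -preimage_setI.
  by move/trivIsetP : tF => /(_ _ _ _ _ ij) ->//; rewrite preimage_set0.
- by rewrite -preimage_bigcup; exact: mcons.
Qed.

HB.instance Definition _ := isMeasure.Build _ _ _ lebesgue_step
  step0 step_ge0 step_sigma_additive.

Let step_sigma_finite : sigma_finite setT lebesgue_step.
Proof.
have /sigma_finiteP[F [TF ndF Foo]] := sigma_finiteT (@lebesgue_measure R).
have /sigma_finiteP[G [TG ndG Goo]] := sigma_finiteT mu.
exists (fun k => rV_uncons @^-1` (F k `*` G k)).
  rewrite -preimage_bigcup (_ : \bigcup_k (F k `*` G k) = setT)//.
  rewrite -setXTT TF TG predeqE => -[x y]; split.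
    by move=> [k _ []/= ? ?]; split; exists k.
  move=> [/= [k _ Fkx] [l _ Gly]]; exists (maxn k l) => //; split.
  - by move: x Fkx; exact/subsetPset/ndF/leq_maxl.
  - by move: y Gly; exact/subsetPset/ndG/leq_maxr.
move=> k; have [mF Fk] := Foo k; have [mG Gk] := Goo k; split.
  rewrite -[X in measurable X]setTI; apply: measurable_rV_uncons => //.
  exact: measurableX.
rewrite /lebesgue_step -comp_preimage.
rewrite (_ : rV_uncons \o rV_cons = id); last first.
  by apply/funext => z; exact: rV_consK.
rewrite (_ : id @^-1` _ = F k `*` G k)//.
by rewrite [ltLHS]product_measure1E// lte_mul_pinfty// ge0_fin_numE.
Qed.

HB.instance Definition _ := @Measure_isSigmaFinite.Build _ _ _ lebesgue_step
  step_sigma_finite.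

End lebesgue_measure_step.

Fixpoint lebesgue_measure_rV {R : realType} (n : nat) :
    {sigma_finite_measure set 'rV[R]_n -> \bar R} :=
  match n with
  | 0 => \d_(0 : 'rV[R]_0)%R
  | n'.+1 => lebesgue_step (lebesgue_measure_rV n')
  end.
Arguments lebesgue_measure_rV {R} n.

Lemma lebesgue_measure_rV_box {R : realType} n (A : 'I_n -> set R) :
  (forall i, measurable (A i)) ->
  lebesgue_measure_rV n [set v : 'rV[R]_n | forall i, A i (v ord0 i)] =
  (\prod_(i < n) lebesgue_measure (A i))%E.
Proof.
elim: n A => [|n IH] A mA.
  rewrite big_ord0 /= diracE mem_set//.
  by case.
rewrite big_ord_recl -(IH (A \o lift ord0)); last by move=> i; exact: mA.
set B := [set v : 'rV[R]_n | _].
have mB : measurable B.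
  rewrite (_ : B = \bigcap_(i in [set: 'I_n])
      (rV_coord i @^-1` A (lift ord0 i))); last first.
    by apply/seteqP; split => v /= Bv i => [_|]; exact: Bv.
  apply: fin_bigcap_measurable => // i _.
  by rewrite -[X in measurable X]setTI; exact: measurable_rV_coord.
rewrite -(product_measure1E (@lebesgue_measure R) (lebesgue_measure_rV n)) //;
  last exact: mA.
rewrite /= /lebesgue_step; congr ((_ \x _)%E _).
apply/seteqP; split => -[x v] /=.
  move=> Av; split => [|i] /=.
    by have := Av ord0; rewrite mxE unlift_none.
  by have := Av (lift ord0 i); rewrite mxE liftK.
move=> [Ax Av] i; rewrite mxE.
by have [j ->|->] := unliftP ord0 i => /=; [exact: Av|].
Qed.

Section lebesgue_spaces_on.
Context d (T : measurableType d) {R : realType}.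
Variable mu : {measure set T -> \bar R}.

Definition Lnorm_on (A : set T) (p : R) (f : T -> R) : \bar R :=
  'N[mu]_p%:E [EFin \o (f \_ A)]%E.

Definition Lfun_on (A : set T) (p : R) (f : T -> R) : Prop :=
  f \_ A \in Lfun mu p%:E.

(* The default value -oo makes points outside A irrelevant. *)
Definition ess_sup_on (A : set T) (f : T -> \bar R) : \bar R :=
  ess_sup mu (patch (fun=> -oo%E) A f).

End lebesgue_spaces_on.

Section function_spaces.
Context {R : realType} {N : nat}.
Local Notation RN := 'rV[R]_N.
Local Notation leb := (@lebesgue_measure R).
Local Notation lebN := (@lebesgue_measure_rV R N).
Local Notation lebNT := (lebN \x leb)%E.

(* Open cube of edge rho, not of half-edge rho. *)
Definition cube (y : RN) (rho : R) : set RN :=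
  [set x | forall i, `|x ord0 i - y ord0 i| < rho / 2].

Definition partial (i : 'I_N) (f : RN -> R) : RN -> R :=
  'D_(delta_mx ord0 i) f.

Fixpoint Ck (k : nat) (f : RN -> R) : Prop :=
  continuous f /\
  match k with
  | 0 => True
  | k'.+1 => forall i : 'I_N,
      (forall x, derivable f x (delta_mx ord0 i)) /\ Ck k' (partial i f)
  end.

Definition Cc_infty (Omega : set RN) (f : RN -> R) : Prop :=
  (forall k, Ck k f) /\
  exists K : set RN,
    [/\ compact K, K `<=` Omega & forall x, ~ K x -> f x = 0].

Definition Cc_infty1 (I : set R) (psi : R -> R) : Prop :=
  (forall k x, derivable (derive1n k psi) x 1) /\
  exists J : set R,
    [/\ compact J, J `<=` I & forall t, ~ J t -> psi t = 0].

(* The vanishing of zeta outside a compact subset of E makes both integrals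
   converge when f and Df are locally integrable, as in W12_loc. *)
Definition weak_gradient (E : set RN) (f : RN -> R) (Df : 'I_N -> RN -> R) :=
  forall zeta, Cc_infty E zeta -> forall i,
    \int[lebN]_(x in E) (f x * partial i zeta x) =
    - \int[lebN]_(x in E) (Df i x * zeta x).

Definition W12_loc (E : set RN) (f : RN -> R) (Df : 'I_N -> RN -> R) :=
  (forall K, compact K -> K `<=` E ->
     Lfun_on lebN K 2 f /\ forall i, Lfun_on lebN K 2 (Df i)) /\
  weak_gradient E f Df.

(* Closure of C_c^oo(K°) in the W^{1,2} norm; Df is the limit of the
   gradients of the approximating functions. *)
Definition W12_0 (K : set RN) (f : RN -> R) (Df : 'I_N -> RN -> R) :=
  [/\ Lfun_on lebN K 2 f, (forall i, Lfun_on lebN K 2 (Df i)) &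
    forall eps : R, 0 < eps -> exists zeta, [/\ Cc_infty K° zeta,
      (Lnorm_on lebN K 2 (fun x => (f x - zeta x)%R) < eps%:E)%E &
      forall i,
        (Lnorm_on lebN K 2 (fun x => (Df i x - partial i zeta x)%R)
           < eps%:E)%E]].

(* Below, "local in time" always refers to the compact subintervals
   [t1, t2] of ]0, T]; the endpoint T is included. *)

Definition C_L2 (T : R) (K : set RN) (v : RN -> R -> R) :=
  forall t0, 0 < t0 <= T -> Lfun_on lebN K 2 (v ^~ t0) /\
    (Lnorm_on lebN K 2 (fun x => (v x t - v x t0)%R)
       @[t --> within `]0, T] (nbhs t0)] --> 0%E).

Definition L2loc_L2 (T : R) (K : set RN) (v : RN -> R -> R) :=
  forall t1 t2, 0 < t1 -> t1 <= t2 -> t2 <= T ->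
    Lfun_on lebNT (K `*` `[t1, t2]) 2 (fun z => v z.1 z.2).

Definition L2loc_W12loc (T : R) (E : set RN) (v : RN -> R -> R)
    (Dv : 'I_N -> RN -> R -> R) :=
  (forall K, compact K -> K `<=` E ->
     L2loc_L2 T K v /\ forall i, L2loc_L2 T K (Dv i)) /\
  {ae leb, forall t, 0 < t <= T -> W12_loc E (v ^~ t) (fun i => Dv i ^~ t)}.

Definition L2loc_W12_0 (T : R) (K : set RN) (v : RN -> R -> R)
    (Dv : 'I_N -> RN -> R -> R) :=
  [/\ L2loc_L2 T K v, (forall i, L2loc_L2 T K (Dv i)) &
  {ae leb, forall t, 0 < t <= T -> W12_0 K (v ^~ t) (fun i => Dv i ^~ t)}].

(* vt is the weak derivative of t |-> v(., t) as a function with values in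
   L^2(K), and v is the representative that is continuous in time, so that its
   values at single times make sense. *)
Definition W12loc_L2 (T : R) (K : set RN) (v vt : RN -> R -> R) :=
  [/\ L2loc_L2 T K v, L2loc_L2 T K vt, C_L2 T K v &
  forall psi, Cc_infty1 `]0, T[ psi ->
    {ae lebN, forall x, K x ->
      \int[leb]_(t in `]0, T[) (v x t * derive1 psi t) =
      - \int[leb]_(t in `]0, T[) (vt x t * psi t)}].

Definition Lrloc (T : R) (E : set RN) (r : R) (v : RN -> R -> R) :=
  forall C : set (RN * R), compact C -> C `<=` E `*` `]0, T] ->
    Lfun_on lebNT C r (fun z => v z.1 z.2).

Definition Linfloc_Lploc (T : R) (E : set RN) (p : R) (v : RN -> R -> R) :=
  forall K t1 t2, compact K -> K `<=` E -> 0 < t1 -> t1 <= t2 -> t2 <= T ->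
    (ess_sup_on leb `[t1, t2] (fun t => Lnorm_on lebN K p (v ^~ t)) < +oo)%E.

Definition weak_equation (T : R) (E : set RN) (u : RN -> R -> R)
    (Dlnu : 'I_N -> RN -> R -> R) :=
  forall (K : set RN) (t1 t2 : R) (phi phit : RN -> R -> R)
      (Dphi : 'I_N -> RN -> R -> R),
    compact K -> K `<=` E -> 0 < t1 -> t1 <= t2 -> t2 <= T ->
    W12loc_L2 T K phi phit -> L2loc_W12_0 T K phi Dphi ->
    \int[lebN]_(x in K) (u x t2 * phi x t2)
    - \int[lebN]_(x in K) (u x t1 * phi x t1)
    + \int[leb]_(t in `[t1, t2]) (\int[lebN]_(x in K)
        (- (u x t * phit x t) + \sum_(i < N) Dlnu i x t * Dphi i x t)) = 0.

(* Since the library sets ln 0 = 0, the almost everywhere positivity that is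
   implicit in the local integrability of ln u has to be required. *)
Definition log_diffusion_solution (T : R) (E : set RN) (u : RN -> R -> R) :=
  [/\ (forall x t, E x -> 0 < t <= T -> 0 <= u x t),
      {ae lebNT, forall z, E z.1 -> 0 < z.2 <= T -> 0 < u z.1 z.2},
      measurable_fun (E `*` `]0, T]) (fun z => u z.1 z.2),
      (forall K, compact K -> K `<=` E -> C_L2 T K u) &
      exists Dlnu : 'I_N -> RN -> R -> R,
        L2loc_W12loc T E (fun x t => ln (u x t)) Dlnu /\
        weak_equation T E u Dlnu].

Definition cyl_sup (u : RN -> R -> R) (y : RN) (rho s t : R) : \bar R :=
  ess_sup_on lebNT (cube y (2 * rho) `*` `]s, t]) (fun z => (u z.1 z.2)%:E).

Definition Lambda (j : nat) (u : RN -> R -> R) (y : RN) (rho s t : R) :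
    \bar R :=
  let Q := cube y (2 * rho) in
  let M := fine (cyl_sup u y rho s t) in
  ess_sup_on leb `[s, t] (fun tau =>
    (((fine (lebN Q))^-1)%:E *
     \int[lebN]_(x in Q) (`|ln (u x tau / M)| ^+ j)%:E) `^ (j%:R^-1))%E.

End function_spaces.

(* Main.v *)
Require Import Defs.
From HB Require Import structures.
From mathcomp Require Import all_boot all_order all_algebra.
From mathcomp Require Import all_classical all_reals all_analysis.
From mathcomp Require Import ring lra measurable_realfun ess_sup_inf.
Set Implicit Arguments.
Unset Strict Implicit.
Unset Printing Implicit Defensive.
Import Order.TTheory GRing.Theory Num.Theory.
Import numFieldNormedType.Exports.
Local Open Scope classical_set_scope.
Local Open Scope ring_scope.

(* Let [zeta] be a smooth cutoff function, bounded below on [cube y rho] and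
   compactly supported in [cube y (2 rho)]. Testing the equation with [zeta] and
   integrating by parts once more in space, the change of [\int u zeta] between
   two times is [\int\int ln u Delta zeta]. As [Delta zeta] has integral zero,
   [ln u] may be replaced by [ln (u / M)], and [|Delta zeta| <= C / rho^2] bounds
   the change by [C rho^-2 (t - s) Lambda_1 |cube y (2 rho)|], that is by
   [C Lambda_1 (t - s) / rho^(2 - N)]. *)

(** The obstacle is that the equation contains [D ln u], while the quantities allowed in [gamma]
    control only [ln (u / M)]. The constant [ln M] can be inserted because each pure second
    derivative of [zeta] has integral zero. Taking [zeta] as a product of one-variable bumps reduces
    this to one dimension: by Fubini a factor splits off which is the derivative of a compactly
    supported function. The test function lives on a closed box inside the open cube of edge
    [2 * rho], since the equation and the local spaces see only compact subsets of [E], and the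
    closure of that cube may leave [E]. The change of mass is bounded in absolute value, so any two
    times can be compared in either order; this is what allows a supremum on one side and an infimum
    on the other. The result is [gamma = (1 + N B 2^N |Lambda_1|) / c^N], where [B] bounds the
    second derivative of the bump, [c] bounds the bump below on [|z| < 1/2], and [2^N] comes from
    the volume [(2 rho)^N]. *)

Section smooth_real_functions.
Context {R : realType}.
Implicit Types (f g : R -> R) (p : {poly R}).

Definition smooth f := forall k x, derivable (derive1n k f) x 1.

(** A coinduction principle: iterated derivatives need not be computed, it is enough to exhibit a
    class of differentiable functions that is stable under differentiation. *)
Lemma smooth_class (S : set (R -> R)) :
  (forall f, S f -> (forall x, derivable f x 1) /\ S (derive1 f)) ->
  forall f, S f -> smooth f.
Proof.
move=> SP f Sf k; elim: k f Sf => [|k IH] f Sf x.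
  by rewrite derive1n0; have [] := SP _ Sf.
by rewrite derive1Sn; apply: IH; have [] := SP _ Sf.
Qed.

Lemma smooth_derivable f x : smooth f -> derivable f x 1.
Proof. by move=> /(_ 0 x). Qed.

Lemma smooth_derive1 f : smooth f -> smooth (derive1 f).
Proof. by move=> sf k x; rewrite -derive1Sn; exact: sf. Qed.

Lemma smooth_continuous f : smooth f -> continuous f.
Proof.
move=> sf x; apply: differentiable_continuous.
exact/derivable1_diffP/smooth_derivable.
Qed.

Lemma smooth_affine f (a b : R) : smooth f -> smooth (fun z => f (a * z + b)).
Proof.
(* The constant [c] absorbs the factor [a] that each differentiation produces. *)
move=> sf; pose S := [set h : R -> R |
  exists c g, smooth g /\ h = fun z => c * g (a * z + b)].
apply: (@smooth_class S); last first.
  by exists 1, f; split => //; apply/funext => z; rewrite mul1r.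
move=> _ [c [g [sg ->]]].
have dz (z : R) : is_derive z 1 (fun z : R => c * g (a * z + b))
    (c * a * derive1 g (a * z + b)).
  have dg : is_derive (a * z + b) 1 g ((derive1 g) (a * z + b)).
    by rewrite derive1E; apply: derivableP; exact: smooth_derivable.
  have da : is_derive z 1 (fun z : R => a * z + b) a.
    by apply: is_derive_eq; rewrite addr0 [LHS]mulr1.
  have D := @is_deriveZ _ _ _ _ c _ _ _
    (@is_derive1_comp _ g (fun z : R => a * z + b) _ _ _ dg da).
  by apply: (is_derive_eq D); rewrite /GRing.scale/=; ring.
split; first by move=> z; have [] := dz z.
exists (c * a), (derive1 g); split; first exact: smooth_derive1.
by apply/funext => z; rewrite derive1E; have [_ ->] := dz z.
Qed.

(** Products alone are not stable under differentiation, because Leibniz' rule yields sums of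
    products; the algebra generated by the smooth functions is. *)
Inductive smooth_algebra : set (R -> R) :=
| smooth_algebra_base f : smooth f -> smooth_algebra f
| smooth_algebra_add f g : smooth_algebra f -> smooth_algebra g ->
    smooth_algebra (f + g)
| smooth_algebra_mul f g : smooth_algebra f -> smooth_algebra g ->
    smooth_algebra (f * g).

Lemma smoothM f g : smooth f -> smooth g -> smooth (f * g).
Proof.
move=> sf sg; apply: (@smooth_class smooth_algebra); last first.
  by apply: smooth_algebra_mul; exact: smooth_algebra_base.
move=> h Sh; clear f g sf sg.
elim: Sh => [f sf|f g Sf [df Sdf] Sg [dg Sdg]|f g Sf [df Sdf] Sg [dg Sdg]].
- split; first by move=> x; exact: smooth_derivable.
  by apply: smooth_algebra_base; exact: smooth_derive1.
- split; first by move=> x; exact: derivableD.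
  rewrite (_ : derive1 (f + g) = derive1 f + derive1 g).
    exact: smooth_algebra_add.
  by apply/funext => x; rewrite !derive1E deriveD// -!derive1E.
- split; first by move=> x; exact: derivableM.
  rewrite (_ : derive1 (f * g) = f * (derive1 g) + g * (derive1 f)).
    by apply: smooth_algebra_add; exact: smooth_algebra_mul.
  by apply/funext => x; rewrite derive1E deriveM// -!derive1E.
Qed.

(** The polynomial parameter makes the family stable under differentiation: on [x > 0] the
    derivative of [p(1/x) exp(-1/x)] is [q(1/x) exp(-1/x)] with [q = (p - p') X^2]. *)
Definition flat_fun p (x : R) : R :=
  if 0 < x then p.[x^-1] * expR (- x^-1) else 0.

(** With [y = 1/x >= 1] and [n = size p], [|p(y)| <= S y^n] while [exp y >= y^(n+1) / (n+1)!]; the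
    one spare power of [y] is the factor [|x|]. *)
Lemma flat_fun_bound p : exists2 C : R, 0 <= C &
  forall x, `|x| <= 1 -> `|flat_fun p x| <= C * `|x|.
Proof.
pose n := size p; pose S : R := \sum_(i < n) `|p`_i|.
have S0 : 0 <= S by apply: sumr_ge0.
exists (S * n.+1`!%:R); first by rewrite mulr_ge0.
move=> x x1; rewrite /flat_fun; case: ifPn => [x0|_]; last first.
  by rewrite normr0 !mulr_ge0.
rewrite gtr0_norm// in x1 *; set y := x^-1.
have y1 : 1 <= y by rewrite invf_ge1.
have y0 : 0 < y by rewrite invr_gt0.
have pS : `|p.[y]| <= S * y ^+ n.
  rewrite horner_coef (le_trans (ler_norm_sum _ _ _))// mulr_suml ler_sum// => i _.
  rewrite normrM ler_wpM2l// normrX (gtr0_norm y0).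
  by rewrite ler_weXn2l// ltnW.
rewrite normrM (gtr0_norm (expR_gt0 _)) expRN ler_pdivrMr ?expR_gt0//.
rewrite (le_trans pS)// -!mulrA ler_wpM2l//.
have := @expR_ge1Dxn R y n (ltW y0) => E.
have {}E : y ^+ n.+1 / n.+1`!%:R <= expR y by lra.
rewrite ler_pdivrMr ?ltr0n ?fact_gt0// in E.
rewrite mulrCA -[X in X <= _](_ : x * y ^+ n.+1 = _).
  by rewrite ler_wpM2l ?(ltW x0)// mulrC.
by rewrite exprS mulrA mulfV ?mul1r// gt_eqF.
Qed.

Lemma flat_fun_cvg0 p : flat_fun p x @[x --> 0^'] --> (0 : R).
Proof.
have [C C0 HC] := flat_fun_bound p.
apply/cvgr0Pnorm_le => e e0.
near=> x.
have x1 : `|x| <= 1.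
  by near: x; apply: dnbhs0_le.
apply: (le_trans (HC _ x1)).
have xe : `|x| <= e / (C + 1).
  by near: x; apply: dnbhs0_le; rewrite divr_gt0// ltr_wpDl.
apply: (@le_trans _ _ (C * (e / (C + 1)))); first exact: ler_wpM2l.
rewrite mulrCA ler_piMr ?(ltW e0)// ler_pdivrMr ?ltr_wpDl//.
by rewrite mul1r lerDl.
Unshelve. all: by end_near. Qed.

End smooth_real_functions.

(** * A smooth bump function on the line *)

Section smooth_bump.
Context {R : realType}.
Implicit Types (f g : R -> R) (p : {poly R}).

Lemma is_derive_flat_fun p (x : R) :
  is_derive x 1 (flat_fun p) (flat_fun ((p - p^`()) * 'X^2) x).
Proof.
have [x0|x0|->] := ltgtP x 0.
- rewrite {2}/flat_fun ltNge (ltW x0)/=.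
  apply: (@near_eq_is_derive _ _ _ (cst 0)) => //.
  near=> y; rewrite /flat_fun ifF//; apply/negbTE; rewrite -leNgt.
  by near: y; exact: lt_le_nbhsl.
- rewrite {2}/flat_fun x0.
  apply: (@near_eq_is_derive _ _ _ (fun x : R => p.[x^-1] * expR (- x^-1) : R)).
    near=> y; rewrite /flat_fun ifT//.
    by near: y; exact: lt_nbhsr.
  have xn0 : x != 0 by rewrite gt_eqF.
  have di : is_derive x 1 (fun x : R => x^-1) (- x ^- 2).
    apply: DeriveDef; first exact: (@derivableV R R^o id).
    by rewrite (@deriveV R R^o id)// derive_id /GRing.scale/= mulr1.
  have dN : is_derive x 1 (fun x : R => - x^-1) (x ^- 2).
    by apply: is_derive_eq; rewrite opprK.
  have dp : is_derive x 1 (fun x : R => p.[x^-1]) (p^`().[x^-1] * - x ^- 2).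
    exact: (@is_derive1_comp _ (horner p) (fun x : R => x^-1)).
  have de : is_derive x 1 (fun x : R => expR (- x^-1)) (expR (- x^-1) * x ^- 2).
    exact: (@is_derive1_comp _ expR (fun x : R => - x^-1)).
  apply: is_derive_eq; rewrite /GRing.scale/= !hornerE/=.
  by rewrite expr2 invfM; ring.
- rewrite {2}/flat_fun ltxx.
  (* The difference quotient of [flat_fun p] at 0 is [flat_fun (p * 'X)], which tends to 0 by
     [flat_fun_cvg0]. *)
  have c : (h^-1 *: ((flat_fun p \o shift 0) (h *: 1) - flat_fun p 0))
      @[h --> 0^'] --> (0 : R).
    apply: cvg_trans (flat_fun_cvg0 (p * 'X)); apply: near_eq_cvg; near=> h.
    rewrite /= addr0 /GRing.scale/= mulr1 {3}/flat_fun ltxx subr0 /flat_fun.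
    case: ifPn => _; last by rewrite mulr0.
    by rewrite !hornerE/=; ring.
  by apply: DeriveDef; [apply/cvg_ex; exists 0|exact: cvg_lim c].
Unshelve. all: by end_near. Qed.

Lemma flat_fun_smooth p : smooth (flat_fun p).
Proof.
apply: (@smooth_class R (range (@flat_fun R))); last by exists p.
move=> _ [q _ <-]; split; first by move=> x; have [] := is_derive_flat_fun q x.
exists ((q - q^`()) * 'X^2) => //.
by apply/funext => x; rewrite derive1E; have [_ ->] := is_derive_flat_fun q x.
Qed.

(** Lengths are in units of [rho], so that the two cubes have half-edges 1/2 and 1. The bump is not
    normalized to 1 on the inner interval; a positive lower bound there suffices and costs only the
    factor [c ^+ N] in [gamma]. *)
Definition bump (z : R) : R := flat_fun 1 (2 / 3 - z) * flat_fun 1 (z + 2 / 3).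

Lemma bump_smooth : smooth bump.
Proof.
apply: smoothM; last first.
  have := @smooth_affine R (flat_fun 1) 1 (2 / 3) (@flat_fun_smooth 1).
  by under eq_fun do rewrite mul1r.
have := @smooth_affine R (flat_fun 1) (-1) (2 / 3) (@flat_fun_smooth 1).
by under eq_fun do rewrite mulN1r addrC.
Qed.

Lemma flat_fun1_ge0 (x : R) : 0 <= flat_fun 1 x.
Proof. by rewrite /flat_fun; case: ifP => // _; rewrite hornerC mul1r expR_ge0. Qed.

Lemma flat_fun1_le1 (x : R) : flat_fun 1 x <= 1.
Proof.
rewrite /flat_fun; case: ifPn => // x0.
by rewrite hornerC mul1r expR_le1 oppr_le0 invr_ge0 ltW.
Qed.

Lemma bump_ge0 (z : R) : 0 <= bump z.
Proof. by rewrite mulr_ge0// flat_fun1_ge0. Qed.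

Lemma bump_le1 (z : R) : bump z <= 1.
Proof. by rewrite mulr_ile1// ?flat_fun1_ge0// flat_fun1_le1. Qed.

Lemma bump_eq0 (z : R) : 2 / 3 <= `|z| -> bump z = 0.
Proof.
rewrite /bump ler_normr => /orP[zl|zl].
  by rewrite {1}/flat_fun ltNge subr_le0 zl/= mul0r.
by rewrite /flat_fun [X in _ * (if X then _ else _)]ltNge -lerBrDr sub0r lerNr zl/= mulr0.
Qed.

Lemma bump_lb : exists2 c : R, 0 < c & forall z : R, `|z| < 2^-1 -> c <= bump z.
Proof.
(* For [|z| < 1/2] both [2/3 - z] and [z + 2/3] exceed [2/3 - 1/2 = 1/6]. *)
have H (z : R) : 6^-1 <= z -> expR (- 6) <= flat_fun 1 z.
  move=> hz; have z0 : 0 < z by apply: lt_le_trans hz.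
  rewrite /flat_fun z0 hornerC mul1r ler_expR lerN2.
  by rewrite -[leRHS]invrK lef_pV2// posrE.
exists (expR (- 6) * expR (- 6)); first by rewrite mulr_gt0// expR_gt0.
move=> z; rewrite ltr_norml => /andP[z1 z2].
by rewrite ler_pM ?expR_ge0// H//; lra.
Qed.

Lemma near_eq_derive1n (k : nat) f g (x : R) :
  (\forall y \near x, f y = g y) -> derive1n k f x = derive1n k g x.
Proof.
elim: k f g x => [|k IH] f g x; first exact: nbhs_singleton.
move=> fg; rewrite !derive1Sn; apply: IH.
apply: filterS (near_join fg) => y yfg.
by rewrite !derive1E; exact: near_eq_derive.
Qed.

(** The strict inequality makes [bump] vanish on a neighbourhood of [z], hence with all its
    derivatives. *)
Lemma bump_derive_eq0 k (z : R) : 2 / 3 < `|z| -> derive1n k bump z = 0.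
Proof.
move=> hz; rewrite (@near_eq_derive1n _ bump (cst 0)).
  elim: k => [//|k IH]; rewrite derive1Sn (_ : derive1 _ = cst 0)//.
  by apply/funext => y; rewrite derive1_cst.
move: hz; rewrite ltr_normr ltrNr => /orP[hz|hz].
- by apply: filterS (lt_le_nbhsr hz) => y yz; rewrite bump_eq0// ler_normr yz.
- apply: filterS (lt_le_nbhsl hz) => y yz.
  by rewrite bump_eq0// ler_normr lerNr yz orbT.
Qed.

Lemma bump_derive_bounded k :
  exists2 B : R, 0 <= B & forall z : R, `|derive1n k bump z| <= B.
Proof.
have sk : smooth (derive1n k bump).
  by elim: k => [|k IH]; [exact: bump_smooth|rewrite derive1nS; exact: smooth_derive1].
have [B [_ HB]] := @compact_bounded _ _ _ (continuous_compact
  (continuous_subspaceT (smooth_continuous sk)) (@segment_compact _ (-1 : R) 1)).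
(* Boundedness on [[-1, 1]] gives every number above [B] as a bound; the absolute value makes the
   witness nonnegative. *)
exists `|B + 1| => // z; have [z1|z1] := leP `|z| 1.
  apply: (le_trans _ (ler_norm _)); apply: HB; first by rewrite ltrDl.
  by exists z => //=; rewrite in_itv/= -ler_norml.
by rewrite bump_derive_eq0 ?normr0//; lra.
Qed.

End smooth_bump.

(** * Functions on R^N that are products of one-variable functions *)

Section product_functions.
Context {R : realType} {N : nat}.
Implicit Types (g : 'I_N -> R -> R) (x : 'rV[R]_N).

Definition prodf g x : R := \prod_i g i (x ord0 i).

(** A partial derivative replaces one factor and so stays within the product functions; this carries
    the induction in [Ck_prodf]. *)
Definition upd g (i : 'I_N) (h : R -> R) : 'I_N -> R -> R :=
  fun j => if j == i then h else g j.

Lemma prodf_upd g i h x :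
  prodf (upd g i h) x = h (x ord0 i) * \prod_(j | j != i) g j (x ord0 j).
Proof.
rewrite /prodf (bigD1 i)//= /upd eqxx; congr (_ * _).
by apply: eq_bigr => j /negbTE ->.
Qed.

Lemma prodfE g i x :
  prodf g x = g i (x ord0 i) * \prod_(j | j != i) g j (x ord0 j).
Proof. by rewrite /prodf (bigD1 i). Qed.

Lemma continuous_prodf g : (forall i, continuous (g i)) -> continuous (prodf g).
Proof.
move=> cg; apply: (@continuous_big R 'I_N *%R 1 xpredT (@mul_continuous R)
    'rV[R]_N (index_enum 'I_N) (fun i x => g i (x ord0 i))) => i _ x.
apply: (@continuous_comp _ _ _ (fun x : 'rV[R]_N => x ord0 i) (g i)).
  exact: coord_continuous.
exact: cg.
Qed.

Lemma measurable_prodf g : (forall i, measurable_fun setT (g i)) ->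
  measurable_fun setT (prodf g).
Proof.
move=> mg; apply: measurable_prod => i _.
apply: (measurableT_comp (mg i)); exact: measurable_rV_coord.
Qed.

(** Along the [i]-th basis vector the other factors do not change, so the difference quotient is a
    constant [c] times that of [g i]. *)
Lemma is_derive_prodf g i x : derivable (g i) (x ord0 i) 1 ->
  is_derive x (delta_mx ord0 i) (prodf g) (prodf (upd g i (derive1 (g i))) x).
Proof.
move=> dgi; set c := \prod_(j | j != i) g j (x ord0 j).
have lhs : (fun h => h^-1 *: ((prodf g \o shift x) (h *: delta_mx ord0 i) - prodf g x)) =
    (fun h => c * (h^-1 *: ((g i \o shift (x ord0 i)) (h *: 1) - g i (x ord0 i)))).
  apply/funext => h; rewrite /= !(prodfE _ i).
  rewrite !mxE !eqxx/= -/c.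
  rewrite (eq_bigr (fun j => g j (x ord0 j))) -/c; last first.
    by move=> j /negbTE ji; rewrite !mxE ji andbF mulr0 add0r.
  rewrite /GRing.scale/=; ring.
have cv : c * (h^-1 *: ((g i \o shift (x ord0 i)) (h *: 1) - g i (x ord0 i)))
     @[h --> 0^'] --> c * derive1 (g i) (x ord0 i).
  by rewrite derive1E; apply: cvgMr => //.
rewrite -lhs in cv.
apply: DeriveDef; first by apply/cvg_ex; exists (c * derive1 (g i) (x ord0 i)).
by rewrite /derive (cvg_lim _ cv)// prodf_upd mulrC.
Qed.

Lemma partial_prodf g i : (forall z, derivable (g i) z 1) ->
  partial i (prodf g) = prodf (upd g i (derive1 (g i))).
Proof.
move=> dg; apply/funext => x; rewrite /partial.
by have [_ ->] := @is_derive_prodf g i x (dg _).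
Qed.

Lemma upd_smooth g i h : (forall j, smooth (g j)) -> smooth h ->
  forall j, smooth (upd g i h j).
Proof. by move=> sg sh j; rewrite /upd; case: ifP. Qed.

Lemma Ck_prodf k g : (forall i, smooth (g i)) -> Ck k (prodf g).
Proof.
elim: k g => [|k IH] g sg; split => //;
  try by apply: continuous_prodf => i; exact: smooth_continuous.
move=> i; split.
  by move=> x; have [] := @is_derive_prodf g i x (@smooth_derivable _ _ _ (sg i)).
rewrite partial_prodf; last by move=> z; exact: smooth_derivable.
by apply: IH; apply: upd_smooth => //; exact: smooth_derive1.
Qed.

End product_functions.

Section integral_product_functions.
Context {R : realType}.
Local Notation leb := (@lebesgue_measure R).
Local Open Scope ereal_scope.

Lemma prodf_rV_cons n (g : 'I_n.+1 -> R -> R) (z : measurableTypeR R * 'rV[R]_n) :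
  prodf g (rV_cons z) = (g ord0 z.1 * prodf (fun i => g (lift ord0 i)) z.2)%R.
Proof.
rewrite /prodf big_ord_recl /rV_cons mxE unlift_none/=; congr (_ * _)%R.
by apply: eq_bigr => i _; rewrite mxE liftK.
Qed.

(** Induction along the construction of the measure, with the Dirac mass in dimension 0 giving the
    empty product. Integrability is carried along with the value because Fubini at each step
    requires it. *)
Lemma integral_prodf n (g : 'I_n -> R -> R) :
  (forall i, leb.-integrable setT (EFin \o g i)) ->
  (lebesgue_measure_rV n).-integrable setT (EFin \o prodf g) /\
  (\int[lebesgue_measure_rV n]_x prodf g x = \prod_i \int[leb]_z g i z)%R.
Proof.
elim: n g => [|n IH] g ig.
  have e : prodf g = cst 1%R by apply/funext => x; rewrite /prodf big_ord0.
  rewrite e; split.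
    apply/integrableP; split; first exact/measurable_EFinP/measurable_cst.
    by rewrite /= integral_dirac// diracT mul1e/= normr1 ltry.
  by rewrite big_ord0 /Rintegral/= integral_dirac// diracT mul1e.
have [iP eP] := IH (fun i => g (lift ord0 i)) (fun i => ig _).
set P := prodf _ in iP eP.
have mg i : measurable_fun setT (g i).
  by apply/measurable_EFinP; exact: measurable_int (ig i).
pose mu := (leb \x lebesgue_measure_rV n).
have /integrableP[mg0 fg0] := ig ord0; have /integrableP[mP fP] := iP.
have mnP : measurable_fun setT (fun v => (`|P v|)%:E).
  by apply/measurable_EFinP; apply: measurableT_comp => //; exact/measurable_EFinP.
have mng0 : measurable_fun setT (fun z : measurableTypeR R => (`|g ord0 z|)%:E).
  by apply/measurable_EFinP; apply: measurableT_comp => //; exact: mg.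
(* Tonelli for the absolute value: the iterated integral factors into two finite integrals. *)
have iF : mu.-integrable setT ((EFin \o prodf g) \o @rV_cons R n).
  apply/integrable12ltyP.
    apply: (measurableT_comp _ (@measurable_rV_cons R n)).
    by apply/measurable_EFinP; exact: measurable_prodf.
  under eq_integral do under eq_integral do
    rewrite /= prodf_rV_cons/= normrM EFinM.
  under eq_integral => x _.
    rewrite ge0_integralZl//.
    over.
  rewrite ge0_integralZr//=; last exact: integral_ge0.
  by apply: lte_mul_pinfty => //;
    [exact: integral_ge0|rewrite ge0_fin_numE// integral_ge0].
have mprod : measurable_fun setT (EFin \o prodf g).
  by apply/measurable_EFinP; exact: measurable_prodf.
split; first exact: (@integrable_pushforward _ _ _ _ _ _ (@measurable_rV_cons R n) mu).
rewrite big_ord_recl -eP /Rintegral.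
rewrite [X in fine X](@integral_pushforward _ _ _ _ _ _ (@measurable_rV_cons R n) mu)//.
rewrite preimage_setT -integral12_prod_meas1//.
rewrite -fineM; [|by apply: integrable_fin_num => //; exact: ig|
  exact: integrable_fin_num].
congr fine; rewrite -(fineK (integrable_fin_num _ iP))// -integralZr//; last exact: ig.
apply: eq_integral => x _.
rewrite fineK; last exact: integrable_fin_num.
rewrite -integralZl//; apply: eq_integral => v _.
by rewrite /= prodf_rV_cons.
Qed.

End integral_product_functions.

(** * Integral estimates without measurability of the integrand *)

Section integral_without_measurability.
Context d (T : measurableType d) {R : realType}.
Variable mu : {measure set T -> \bar R}.
Implicit Types (A B D : set T).
Local Open Scope ereal_scope.

Import HBNNSimple.

(* The time slices of the weak equation are not known to be measurable in time,
   but integrals of nonnegative functions are suprema over the simple functions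
   below them. *)
Lemma ge0_le_integral_nomeas A B (f g : T -> \bar R) : A `<=` B ->
  (forall x, B x -> 0 <= g x) -> (forall x, A x -> 0 <= f x <= g x) ->
  \int[mu]_(x in A) f x <= \int[mu]_(x in B) g x.
Proof.
move=> AB g0 fg; rewrite !ge0_integralE//; last by move=> x /fg/andP[].
apply: ge_ereal_sup => _ [h/= hf <-]; apply: ereal_sup_ubound; exists h => //= x.
apply: le_trans (hf x) _; rewrite !patchE; case: ifPn => [/set_mem Ax|_].
  by rewrite mem_set; [case/andP: (fg _ Ax)|exact: AB].
by case: ifPn => // /set_mem /g0.
Qed.

Lemma ge0_integral_le_cst D (f : T -> \bar R) (c : R) : measurable D ->
  (forall x, D x -> 0 <= f x) -> (0 <= c)%R ->
  {ae mu, forall x, D x -> f x <= c%:E} ->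
  \int[mu]_(x in D) f x <= c%:E * mu D.
Proof.
move=> mD f0 c0 fc; rewrite -integral_cst// integral_mkcond.
rewrite ge0_integralTE; last first.
  by move=> x; rewrite patchE; case: ifPn => // /set_mem /f0.
apply: ge_ereal_sup => _ [h/= hf <-]; rewrite -integralT_nnsfun [leRHS]integral_mkcond.
apply: ae_ge0_le_integral => //.
- by move=> x _; rewrite lee_fin.
- exact/measurable_EFinP.
- by move=> x _; rewrite patchE; case: ifPn.
- exact/(measurable_restrictT _ _).1/measurable_cst.
apply: filterS fc => x fx _; apply: le_trans (hf x) _.
by rewrite !patchE; case: ifPn => // /set_mem /fx.
Qed.

(** The positive and negative parts both have integrals in [[0, c * mu D]], so their difference has
    absolute value at most [c * mu D]. Passing through the integral of [|f|] would call for
    additivity, hence for measurability. *)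
Lemma normr_Rintegral_le_cst D (f : T -> R) (c : R) : measurable D ->
  mu D < +oo -> (0 <= c)%R -> {ae mu, forall x, D x -> (`|f x| <= c)%R} ->
  (`|\int[mu]_(x in D) f x| <= c * fine (mu D))%R.
Proof.
move=> mD Doo c0 fc.
have Dfin : mu D \is a fin_num by rewrite ge0_fin_numE.
have H (g : T -> \bar R) : (forall x, 0 <= g x) -> (forall x, g x <= `|(f x)%:E|) ->
    exists2 r : R, \int[mu]_(x in D) g x = r%:E & (0 <= r <= c * fine (mu D))%R.
  move=> g0 gf.
  have I0 : 0 <= \int[mu]_(x in D) g x by exact: integral_ge0.
  have I1 : \int[mu]_(x in D) g x <= (c * fine (mu D))%:E.
    rewrite EFinM fineK//; apply: ge0_integral_le_cst => //.
    by apply: filterS fc => x fx Dx; apply: le_trans (gf x) _; rewrite lee_fin fx.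
  have If : \int[mu]_(x in D) g x \is a fin_num.
    by rewrite ge0_fin_numE// (le_lt_trans I1)// ltry.
  by exists (fine (\int[mu]_(x in D) g x)); rewrite ?fineK// -!lee_fin fineK// I0.
have [a ea /andP[a0 ac]] : exists2 r : R, \int[mu]_(x in D) (EFin \o f)^\+ x = r%:E &
    (0 <= r <= c * fine (mu D))%R.
  apply: H => x; first exact: funepos_ge0.
  by rewrite -/((abse \o (EFin \o f)) x) fune_abse leeDl.
have [b eb /andP[b0 bc]] : exists2 r : R, \int[mu]_(x in D) (EFin \o f)^\- x = r%:E &
    (0 <= r <= c * fine (mu D))%R.
  apply: H => x; first exact: funeneg_ge0.
  by rewrite -/((abse \o (EFin \o f)) x) fune_abse leeDr.
rewrite /Rintegral integralE [X in X - _]ea [X in _ - X]eb /=.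
by rewrite ler_norml; apply/andP; split; lra.
Qed.

End integral_without_measurability.

Section almost_everywhere_sections.
Context d1 d2 (T1 : measurableType d1) (T2 : measurableType d2) {R : realType}.
Variable m1 : {sigma_finite_measure set T1 -> \bar R}.
Variable m2 : {sigma_finite_measure set T2 -> \bar R}.

(** By Tonelli the measures of the slices of a null set integrate to 0, so almost every slice is
    null. *)
Lemma ae_ysection (P : T1 * T2 -> Prop) :
  {ae (m1 \x m2)%E, forall z, P z} ->
  {ae m2, forall t, {ae m1, forall x, P (x, t)}}.
Proof.
move=> [A [mA A0 PA]].
have /ae_eq_integral_abs : (\int[m2]_t `|(m1 \o ysection A) t| = 0)%E.
  under eq_integral do rewrite gee0_abs//.
  rewrite -indic_fubini_tonelli_GE// -indic_fubini_tonelli// -indic_fubini_tonelli1//.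
  by rewrite integral_indic// setIT.
move=> /(_ measurableT (measurable_fun_ysection m1 mA)).
apply: filterS => t /(_ I) /= At; exists (ysection A t); split => //.
  exact: measurable_ysection.
by move=> x /= nP; apply/mem_set/PA.
Qed.

End almost_everywhere_sections.

Section lfun_on.
Context d (T : measurableType d) {R : realType}.
Variable mu : {measure set T -> \bar R}.
Implicit Types (A : set T) (f g : T -> R).

Lemma Lfun_on_measurable A p f : measurable A ->
  Lfun_on mu A p f -> measurable_fun A f.
Proof.
move=> mA; rewrite /Lfun_on inE => /andP[+ _]; rewrite inE/= => mf.
by apply/(measurable_restrictT _ mA).
Qed.

Lemma Lfun_on_bounded A f (B : R) : measurable A -> (mu A < +oo)%E ->
  measurable_fun A f -> (forall x, A x -> `|f x| <= B) -> Lfun_on mu A 2 f.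
Proof.
move=> mA Aoo mf fB; rewrite /Lfun_on inE; apply/andP; split.
  by rewrite inE/=; apply/(measurable_restrictT _ mA).
rewrite inE/= /finite_norm unlock /=; apply: poweR_lty.
have e : (fun x => (`|(f \_ A) x| `^ 2)%:E) = (fun x => (`|f x| `^ 2)%:E) \_ A.
  apply/funext => x; rewrite !patchE; case: ifPn => // _.
  by rewrite normr0 powR0.
rewrite e -integral_mkcond.
apply: (@le_lt_trans _ _ ((B ^+ 2)%:E * mu A)%E).
  apply: ge0_integral_le_cst => //.
  - exact: exprn_even_ge0.
  - apply: aeW => x Ax; rewrite lee_fin powR_mulrn//.
    by rewrite lerXn2r ?nnegrE// ?fB// (le_trans _ (fB _ Ax)).
by rewrite lte_mul_pinfty// lee_fin exprn_even_ge0.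
Qed.

Lemma Lfun_on_integrableM A f g : measurable A ->
  Lfun_on mu A 2 f -> Lfun_on mu A 2 g ->
  mu.-integrable A (fun x => (f x * g x)%:E).
Proof.
move=> mA lf lg; apply/(integrable_mkcond _ mA).
have /Lfun1_integrable := Lfun2_mul_Lfun1 lf lg.
apply: eq_integrable => // x _; rewrite /= !patchE.
by case: ifPn => //; rewrite mulr0.
Qed.

End lfun_on.

Section derivative_integrals.
Context {R : realType}.
Implicit Types (f g : R -> R).
Local Notation leb := (@lebesgue_measure R).

Lemma derive1n_smooth f k : smooth f -> smooth (derive1n k f).
Proof.
move=> sf; elim: k => [|k IH]; first exact: sf.
by rewrite derive1nS; exact: (@smooth_derive1 _ _ IH).
Qed.

Lemma derive1n_affine f (a b : R) k : smooth f ->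
  derive1n k (fun z => f (a * z + b)) =
  fun z => a ^+ k * derive1n k f (a * z + b).
Proof.
move=> sf; elim: k => [|k IH]; first by apply/funext => z; rewrite expr0 mul1r.
rewrite derive1nS IH; apply/funext => z.
have dg : is_derive (a * z + b) 1 (derive1n k f) (derive1n k.+1 f (a * z + b)).
  by rewrite derive1nS derive1E; apply: derivableP; exact: (sf k).
have da : is_derive z 1 (fun z : R => a * z + b) a.
  by apply: is_derive_eq; rewrite addr0 [LHS]mulr1.
have D := @is_deriveZ _ _ _ _ (a ^+ k) _ _ _
  (@is_derive1_comp _ (derive1n k f) (fun z : R => a * z + b) _ _ _ dg da).
rewrite derive1E; have [_ ->] := D; rewrite exprS /GRing.scale/=; ring.
Qed.

Lemma Rintegral_derive1_eq0 f (a b : R) : a < b ->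
  (forall z, derivable f z 1) -> continuous (derive1 f) ->
  f a = 0 -> f b = 0 -> \int[leb]_(z in `]a, b[) derive1 f z = 0.
Proof.
move=> ab df cdf fa fb.
have cf : continuous f.
  by move=> z; apply: differentiable_continuous; exact/derivable1_diffP.
have mdf : measurable_fun [set: R] (derive1 f) by exact: continuous_measurable_fun.
rewrite /Rintegral -(@integral_itv_bndoo _ _ _ _ true false); last first.
  by apply/measurable_EFinP; exact: measurable_funTS.
have LR : derivable_oo_LRcontinuous f a b.
  split=> [z _||]; first exact: df.
  - by apply: cvg_at_right_filter; exact: cf.
  - by apply: cvg_at_left_filter; exact: cf.
rewrite (continuous_FTC2 ab (continuous_subspaceT cdf) LR (fun _ _ => erefl)).
by rewrite fa fb sube0.
Qed.

Lemma integrable_bounded_support f (a b B : R) : measurable_fun setT f ->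
  (forall z, `|f z| <= B) -> (forall z, ~ `]a, b[%classic z -> f z = 0) ->
  leb.-integrable setT (EFin \o f).
Proof.
move=> mf fB f0.
have e : EFin \o f = (EFin \o f) \_ `]a, b[%classic.
  apply/funext => z; rewrite patchE; case: ifPn => //; rewrite notin_setE => nz.
  by rewrite /= f0.
rewrite e; apply/(integrable_mkcond _ _).1 => //.
apply: (@le_integrable _ _ _ _ _ _ _ (cst B%:E)) => //.
- by apply/measurable_EFinP; exact: measurable_funTS.
- by move=> z _; rewrite /= lee_fin (le_trans (fB z))// ler_norm.
- apply/integrableP; split; first exact: measurable_cst.
  rewrite (eq_integral (cst `|B|%:E))// integral_cst//.
  apply: lte_mul_pinfty => //.
  rewrite [ltLHS](@lebesgue_measure_itv R `]a, b[)/=.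
  by case: ifP => // _; rewrite -EFinD ltry.
Qed.

End derivative_integrals.

(** * Open cubes and compact boxes *)

Section boxes.
Context {R : realType} {N : nat}.
Implicit Types (x y : 'rV[R]_N).
Local Notation lebN := (@lebesgue_measure_rV R N).

Lemma measurable_box (A : 'I_N -> set R) : (forall i, measurable (A i)) ->
  measurable [set v : 'rV[R]_N | forall i, A i (v ord0 i)].
Proof.
move=> mA; rewrite (_ : mkset _ = \bigcap_(i in [set: 'I_N])
    (rV_coord i @^-1` A i)); last first.
  by apply/seteqP; split => v /= Bv i => [_|]; exact: Bv.
apply: fin_bigcap_measurable => // i _.
by rewrite -[X in measurable X]setTI; exact: measurable_rV_coord.
Qed.

(** Here [r] is the half-edge, whereas [cube] takes the edge. Compactness makes these boxes
    admissible as the set [K] of the weak formulation. *)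
Definition cbox y (r : R) : set 'rV[R]_N :=
  [set x | forall i, `|x ord0 i - y ord0 i| <= r].

Lemma cboxE y r : cbox y r =
  [set x | forall i, `[y ord0 i - r, y ord0 i + r]%classic (x ord0 i)].
Proof.
apply/seteqP; split => x /= H i; have := H i;
  by rewrite /= in_itv/= ler_distl.
Qed.

Lemma cubeE y r : cube y r =
  [set x | forall i, `]y ord0 i - r / 2, y ord0 i + r / 2[%classic (x ord0 i)].
Proof.
apply/seteqP; split => x /= H i; have := H i;
  by rewrite /= in_itv/= ltr_distl.
Qed.

Lemma measurable_cbox y r : measurable (cbox y r).
Proof. by rewrite cboxE; apply: (measurable_box (A := fun i => `[_, _]%classic)). Qed.

Lemma measurable_cube y r : measurable (cube y r).
Proof. by rewrite cubeE; apply: (measurable_box (A := fun i => `]_, _[%classic)). Qed.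

Lemma compact_cbox y r : compact (cbox y r).
Proof.
rewrite cboxE; apply: (@rV_compact R N
  (fun i => `[y ord0 i - r, y ord0 i + r]%classic)) => i.
exact: segment_compact.
Qed.

Lemma lebesgue_cube y r : 0 < r -> lebN (cube y r) = (r ^+ N)%:E.
Proof.
move=> r0; rewrite cubeE.
rewrite (@lebesgue_measure_rV_box R N
  (fun i => `]y ord0 i - r / 2, y ord0 i + r / 2[%classic))//.
under eq_bigr => i _.
  rewrite lebesgue_measure_itv/= lte_fin ifT; last by lra.
  rewrite -EFinD (_ : _ - _ = r); last by lra.
  over.
by rewrite prodEFin big_const_ord iter_mulr_1.
Qed.

Lemma cbox_sub_cube y r s : r < s / 2 -> cbox y r `<=` cube y s.
Proof. by move=> rs x xr i; apply: le_lt_trans (xr i) rs. Qed.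

Lemma cbox_sub_double_cube y r : 0 < r -> cbox y (3 / 4 * r) `<=` cube y (2 * r).
Proof. by move=> r0; apply: cbox_sub_cube; lra. Qed.

Lemma lebesgue_cbox_lty y r : (lebN (cbox y r) < +oo)%E.
Proof.
have r0 : 0 < 2 * (`|r| + 1) :> R by have := normr_ge0 r; lra.
apply: (@le_lt_trans _ _ (lebN (cube y (2 * (`|r| + 1))))).
  apply: le_measure; rewrite ?inE; [exact: measurable_cbox|exact: measurable_cube|].
  by apply: cbox_sub_cube; have := ler_norm r; lra.
by rewrite lebesgue_cube// ltry.
Qed.

Lemma cube_sub_cbox y r s : r / 2 <= s -> cube y r `<=` cbox y s.
Proof. by move=> rs x xr i; apply: ltW; apply: lt_le_trans (xr i) rs. Qed.

Lemma cube_sub_cbox34 y r : 0 < r -> cube y r `<=` cbox y (3 / 4 * r).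
Proof. by move=> r0; apply: cube_sub_cbox; lra. Qed.

Lemma cbox_interior y r s : r < s -> cbox y r `<=` (cbox y s)°.
Proof.
move=> rs x xr; apply/nbhs_ballP; exists (s - r) => /=; first by rewrite subr_gt0.
move=> z [_ xz] i; have := xz ord0 i; rewrite /ball/= distrC => xzi.
rewrite -(subrKA (x ord0 i)) (le_trans (ler_normD _ _))//.
by have := xr i; lra.
Qed.

End boxes.

(** * The cutoff function and its derivatives *)

Section cutoff.
Context {R : realType} {N : nat}.
Variables (y : 'rV[R]_N) (rho : R).
Hypothesis rho0 : 0 < rho.
Implicit Types (x : 'rV[R]_N) (a : 'I_N -> nat).

Definition cutoff_factor (i : 'I_N) (z : R) : R :=
  bump (rho^-1 * z + - (rho^-1 * y ord0 i)).

(* The mixed partial derivative of multi-order [a] of the cutoff function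
   [prod_i bump ((x_i - y_i) / rho)]. Since 1/2 < 2/3 < 3/4 < 1, the cutoff
   function is positive on [cube y rho], vanishes off [cbox y (2/3 rho)], and
   [cbox y (3/4 rho)] is a compact subset of [cube y (2 rho)]. *)
Definition cutoff a : 'rV[R]_N -> R :=
  prodf (fun i => derive1n (a i) (cutoff_factor i)).

Lemma cutoff_factor_smooth i : smooth (cutoff_factor i).
Proof. by apply: smooth_affine; exact: bump_smooth. Qed.

Lemma cutoff_factorE i k z : derive1n k (cutoff_factor i) z =
  rho^-1 ^+ k * derive1n k bump ((z - y ord0 i) / rho).
Proof.
rewrite /cutoff_factor derive1n_affine; last exact: bump_smooth.
by rewrite -mulrBr [_^-1 * (z - _)]mulrC.
Qed.

Lemma cutoff_factor_eq0 i k z : 2 / 3 * rho < `|z - y ord0 i| ->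
  derive1n k (cutoff_factor i) z = 0.
Proof.
move=> h; rewrite cutoff_factorE bump_derive_eq0 ?mulr0//.
by rewrite normrM normfV (gtr0_norm rho0) ltr_pdivlMr.
Qed.

Lemma cutoff_factor_bounded i k :
  exists2 B : R, 0 <= B & forall z, `|derive1n k (cutoff_factor i) z| <= B.
Proof.
have [B B0 HB] := @bump_derive_bounded R k.
have r0 : 0 <= rho^-1 ^+ k by rewrite exprn_ge0// invr_ge0 ltW.
exists (rho^-1 ^+ k * B); first by rewrite mulr_ge0.
by move=> z; rewrite cutoff_factorE normrM (ger0_norm r0) ler_wpM2l.
Qed.

Lemma measurable_cutoff_factor i k :
  measurable_fun [set: R] (derive1n k (cutoff_factor i)).
Proof.
apply: continuous_measurable_fun; apply: smooth_continuous.
by apply: derive1n_smooth; exact: cutoff_factor_smooth.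
Qed.

Lemma measurable_cutoff a : measurable_fun setT (cutoff a).
Proof. by apply: measurable_prodf => i; exact: measurable_cutoff_factor. Qed.

Lemma partial_cutoff a i :
  partial i (cutoff a) = cutoff (fun j => a j + (j == i))%N.
Proof.
rewrite /cutoff partial_prodf.
  congr prodf; apply/funext => j; rewrite /upd.
  by case: eqVneq => [->|_]; rewrite ?addn0// addn1 derive1nS.
by move=> z; exact: (@cutoff_factor_smooth i (a i)).
Qed.

Lemma cutoff_eq0 a x : ~ cbox y (2 / 3 * rho) x -> cutoff a x = 0.
Proof.
move=> /existsNP[i /negP]; rewrite -ltNge => xi.
by rewrite /cutoff (prodfE _ i) cutoff_factor_eq0// mul0r.
Qed.

Lemma cutoff_Cc_infty a (Omega : set 'rV[R]_N) :
  cbox y (2 / 3 * rho) `<=` Omega -> Cc_infty Omega (cutoff a).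
Proof.
move=> sub; split.
  move=> k; apply: Ck_prodf => i.
  by apply: derive1n_smooth; exact: cutoff_factor_smooth.
exists (cbox y (2 / 3 * rho)); split => //; first exact: compact_cbox.
by move=> x; exact: cutoff_eq0.
Qed.

Lemma cutoff_bounded a : exists B : R, forall x, `|cutoff a x| <= B.
Proof.
have /choice[B HB] : forall i, exists B, forall z,
    `|derive1n (a i) (cutoff_factor i) z| <= B.
  by move=> i; have [B _ HB] := cutoff_factor_bounded i (a i); exists B.
exists (\prod_i B i) => x; rewrite /cutoff /prodf normr_prod.
by apply: ler_prod => i _; rewrite normr_ge0 HB.
Qed.

Lemma cutoff0_ge0 x : 0 <= cutoff (fun=> 0) x.
Proof. by apply: prodr_ge0 => i _; rewrite cutoff_factorE mulr_ge0// bump_ge0. Qed.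

Lemma cutoff0_le1 x : cutoff (fun=> 0) x <= 1.
Proof.
by apply: prodr_ile1 => i; rewrite bump_ge0 bump_le1.
Qed.

Lemma cutoff0_ge (c : R) : 0 < c -> (forall z : R, `|z| < 2^-1 -> c <= bump z) ->
  forall x, cube y rho x -> c ^+ N <= cutoff (fun=> 0) x.
Proof.
move=> c0 hc x xy; rewrite -[N in c ^+ N]card_ord -prodr_const.
apply: ler_prod => i _; rewrite (ltW c0) cutoff_factorE expr0 mul1r hc//.
rewrite normrM normfV (gtr0_norm rho0) ltr_pdivrMr// mulrC.
exact: xy.
Qed.

(** Both derivatives fall on the [i]-th factor, each contributing [rho^-1] by the chain rule; the
    remaining factors are values of [bump], hence in [[0, 1]]. *)
Lemma cutoff2_bound i (B : R) : (forall z : R, `|derive1n 2 bump z| <= B) ->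
  forall x, `|cutoff (fun j => (j == i) + (j == i))%N x| <= B / rho ^+ 2.
Proof.
move=> HB x; rewrite /cutoff (prodfE _ i) eqxx normrM.
have B0 : 0 <= B by apply: le_trans (HB 0).
rewrite -[leRHS]mulr1 ler_pM//.
  rewrite cutoff_factorE normrM exprVn ger0_norm ?invr_ge0 ?exprn_ge0 ?(ltW rho0)//.
  by rewrite mulrC ler_wpM2r// invr_ge0 exprn_ge0 ?(ltW rho0).
rewrite normr_prod; apply: prodr_ile1 => j /negbTE ->.
rewrite -[(false + false)%N]/0%N normr_ge0 cutoff_factorE expr0 mul1r.
by rewrite ger0_norm ?bump_ge0 ?bump_le1.
Qed.

(** The integral is a product of one-dimensional ones, and the [i]-th is that of a derivative of a
    function vanishing at both ends of an interval containing its support. *)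
Lemma integral_cutoff_eq0 a i : (0 < a i)%N ->
  (lebesgue_measure_rV N).-integrable setT (EFin \o cutoff a) /\
  \int[lebesgue_measure_rV N]_x cutoff a x = 0.
Proof.
move=> ai.
have rho23 : 2 / 3 * rho < rho by rewrite gtr_pMl//; lra.
have supp j k (z : R) : ~ `]y ord0 j - rho, y ord0 j + rho[%classic z ->
    derive1n k (cutoff_factor j) z = 0.
  move=> nz; apply: cutoff_factor_eq0; rewrite ltNge; apply/negP => h; apply: nz.
  by rewrite /= in_itv/= -ltr_distl (le_lt_trans h).
have := @integral_prodf R N (fun i => derive1n (a i) (cutoff_factor i)).
case.
  move=> j; have [B _ HB] := cutoff_factor_bounded j (a j).
  apply: (integrable_bounded_support (measurable_cutoff_factor _ _) HB) => z.
  exact: supp.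
move=> iP eP; split => //; rewrite [LHS]eP (bigD1 i)//=.
have -> : (a i = (a i).-1.+1)%N by rewrite prednK.
set k := (a i).-1; rewrite derive1nS.
have sk : smooth (derive1n k (cutoff_factor i)).
  by apply: derive1n_smooth; exact: cutoff_factor_smooth.
have -> : derive1 (derive1n k (cutoff_factor i)) =
  derive1 (derive1n k (cutoff_factor i)) \_ `]y ord0 i - rho, y ord0 i + rho[%classic.
  apply/funext => z; rewrite patchE; case: ifPn => //; rewrite notin_setE.
  by rewrite -derive1nS; exact: supp.
rewrite -Rintegral_mkcond Rintegral_derive1_eq0 ?mul0r//.
- by lra.
- by move=> z; exact: (sk 0).
- by apply: smooth_continuous; exact: smooth_derive1.
- by apply: supp; rewrite /= in_itv/= ltxx.
- by apply: supp; rewrite /= in_itv/= ltxx andbF.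
Qed.

End cutoff.

(** * Functions constant in time are admissible test functions *)

Section time_independent_test_functions.
Context {R : realType} {N : nat}.
Local Notation leb := (@lebesgue_measure R).
Local Notation lebN := (@lebesgue_measure_rV R N).
Implicit Types (K : set 'rV[R]_N) (f : 'rV[R]_N -> R).

Lemma L2loc_L2_cst (T : R) K f (B : R) : measurable K -> (lebN K < +oo)%E ->
  measurable_fun setT f -> (forall x, `|f x| <= B) ->
  L2loc_L2 T K (fun x _ => f x).
Proof.
move=> mK Koo mf fB t1 t2 _ t12 _; apply: (Lfun_on_bounded (B := B)) => //.
- exact: measurableX.
- rewrite [ltLHS]product_measure1E// lte_mul_pinfty// ?ge0_fin_numE//.
  rewrite [ltLHS](@lebesgue_measure_itv R `[t1, t2])/=.
  by case: ifP => // _; rewrite -EFinD ltry.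
- by apply: measurable_funTS; apply: measurableT_comp.
Qed.

Lemma Lnorm_on_eq0 K f : (forall x, f x = 0) -> Lnorm_on lebN K 2 f = 0%E.
Proof.
move=> f0; rewrite /Lnorm_on (_ : _ \o _ = cst 0%E) ?Lnorm0//.
by apply/funext => x /=; rewrite patchE f0; case: ifP.
Qed.

Lemma W12loc_L2_cst (T : R) K f (B : R) : 0 < T ->
  measurable K -> (lebN K < +oo)%E ->
  measurable_fun setT f -> (forall x, `|f x| <= B) ->
  W12loc_L2 T K (fun x _ => f x) (fun _ _ => 0).
Proof.
move=> T0 mK Koo mf fB; split.
- exact: (@L2loc_L2_cst T K f B).
- by apply: (@L2loc_L2_cst T K (cst 0) 0) => // x; rewrite normr0.
- move=> t0 _; split.
    by apply: (Lfun_on_bounded (B := B)) => //; exact: measurable_funTS.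
  rewrite (_ : (fun _ => _) = cst 0%E); first exact: cvg_cst.
  by apply/funext => t; apply: Lnorm_on_eq0 => x; rewrite subrr.
(* That the weak time derivative is 0 means that [f x * psi'] has integral 0 over []0, T[]; indeed
   [psi] vanishes at 0 and [T], its support being inside. *)
- move=> psi [dpsi [J [_ JT psi0]]]; apply: aeW => x _.
  have spsi : smooth psi by [].
  have d1 : derive1 (fun t => f x * psi t) = fun t => f x * derive1 psi t.
    by apply/funext => t; rewrite derive1Ml//; exact: (spsi 0).
  under [in RHS]eq_Rintegral do rewrite mul0r.
  rewrite [X in _ = - X]/Rintegral integral0/= oppr0 -d1.
  apply: Rintegral_derive1_eq0 => //.
  + by move=> z; apply: derivableM => //; exact: (spsi 0).
  + rewrite d1 => z; apply: cvgMr.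
    exact: (smooth_continuous (smooth_derive1 spsi)).
  + by rewrite psi0 ?mulr0// => /JT /=; rewrite in_itv/= ltxx.
  + by rewrite psi0 ?mulr0// => /JT /=; rewrite in_itv/= ltxx andbF.
Qed.

Lemma W12_0_Cc_infty K f (B : R) : measurable K -> (lebN K < +oo)%E ->
  Cc_infty K° f -> measurable_fun setT f -> (forall x, `|f x| <= B) ->
  (forall i, measurable_fun setT (partial i f)) ->
  (forall i, exists B' : R, forall x, `|partial i f x| <= B') ->
  W12_0 K f (fun i => partial i f).
Proof.
move=> mK Koo fK mf fB mDf DfB; split.
- by apply: (Lfun_on_bounded (B := B)) => //; exact: measurable_funTS.
- move=> i; have [B' HB'] := DfB i.
  by apply: (Lfun_on_bounded (B := B')) => //; exact: measurable_funTS.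
- move=> eps e0; exists f; split => // [|i]; rewrite Lnorm_on_eq0 ?lte_fin//;
    by move=> x; rewrite subrr.
Qed.

End time_independent_test_functions.

(** * Moving the gradient from [ln u] to the cutoff *)

Section spatial_integration_by_parts.
Context {R : realType} {N : nat}.
Local Notation lebN := (@lebesgue_measure_rV R N).

Lemma Rintegral_support d (T : measurableType d) (mu : {measure set T -> \bar R})
    (A B : set T) (f : T -> R) : A `<=` B -> (forall x, ~ A x -> f x = 0) ->
  \int[mu]_(x in B) f x = \int[mu]_(x in A) f x.
Proof.
move=> AB f0; rewrite Rintegral_mkcond [RHS]Rintegral_mkcond; congr Rintegral.
apply/funext => x; rewrite !patchE; case: (boolP (x \in A)) => [/set_mem/AB xB|].
  by rewrite mem_set.
by rewrite notin_setE => /f0 ->; case: ifP.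
Qed.

(** The weak gradient is tested with the [i]-th partial derivative of the cutoff. The constant [m]
    is arbitrary because the resulting second derivative has integral zero; it will be [ln M]. *)
Lemma weak_gradient_cutoff_bound (E : set 'rV[R]_N) (y : 'rV[R]_N) (rho : R)
    (v : 'rV[R]_N -> R) (Dv : 'I_N -> 'rV[R]_N -> R) (m B : R) (i : 'I_N) :
  0 < rho -> cbox y (3 / 4 * rho) `<=` E -> W12_loc E v Dv ->
  (forall z : R, `|derive1n 2 bump z| <= B) ->
  ((`|\int[lebN]_(x in cbox y (3 / 4 * rho))
     (Dv i x * partial i (cutoff y rho (fun=> 0%N)) x)|)%:E <=
  (B / rho ^+ 2)%:E *
    \int[lebN]_(x in cbox y (3 / 4 * rho)) (`|v x - m|)%:E)%E.
Proof.
move=> rho0 KE [L2v wg] HB.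
set K := cbox y _.
have mK : measurable K by exact: measurable_cbox.
have cK : compact K by exact: compact_cbox.
have Koo : (lebN K < +oo)%E by exact: lebesgue_cbox_lty.
have [lv lDv] := L2v K cK KE.
pose a1 : 'I_N -> nat := fun j => j == i.
pose a2 : 'I_N -> nat := fun j => ((j == i) + (j == i))%N.
have p1 : partial i (cutoff y rho (fun=> 0%N)) = cutoff y rho a1.
  exact: partial_cutoff.
have p2 : partial i (cutoff y rho a1) = cutoff y rho a2 by exact: partial_cutoff.
have K23 : cbox y (2 / 3 * rho) `<=` K.
  by move=> x H j; apply: le_trans (H j) _; rewrite ler_pM2r//; lra.
have z0 a x : ~ K x -> cutoff y rho a x = 0.
  by move=> nK; apply: cutoff_eq0 => // /K23.
have [C2 HC2] := cutoff_bounded y rho0 a2.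
have l2 : Lfun_on lebN K 2 (cutoff y rho a2).
  apply: (Lfun_on_bounded (B := C2)) => //.
  by apply: measurable_funTS; exact: measurable_cutoff.
have lc : Lfun_on lebN K 2 (cst m).
  by apply: (Lfun_on_bounded (B := `|m|)).
have iv := Lfun_on_integrableM mK lv l2.
have im := Lfun_on_integrableM mK lc l2.
have e1 : \int[lebN]_(x in K) (Dv i x * cutoff y rho a1 x) =
    - \int[lebN]_(x in K) (v x * cutoff y rho a2 x).
  rewrite -(Rintegral_support _ KE); last by move=> x /z0 ->; rewrite mulr0.
  rewrite -(Rintegral_support _ KE); last by move=> x /z0 ->; rewrite mulr0.
  have /wg/(_ i) : Cc_infty E (cutoff y rho a1).
    by apply: cutoff_Cc_infty => //; exact: subset_trans KE.
  by rewrite p2 => ->; rewrite opprK.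
have e2 : \int[lebN]_(x in K) (v x * cutoff y rho a2 x) =
    \int[lebN]_(x in K) ((v x - m) * cutoff y rho a2 x).
  have [ic c0] : lebN.-integrable setT (EFin \o cutoff y rho a2) /\
      \int[lebN]_x cutoff y rho a2 x = 0.
    by apply: (@integral_cutoff_eq0 _ _ _ _ _ _ i) => //; rewrite /a2 eqxx.
  under [RHS]eq_Rintegral do rewrite mulrBl.
  rewrite RintegralB// RintegralZl//; last exact: integrableS ic.
  rewrite -[X in m * X](@Rintegral_support _ _ lebN K setT)//; last exact: z0.
  by rewrite c0 mulr0 subr0.
have ivm : lebN.-integrable K (fun x => ((v x - m) * cutoff y rho a2 x)%:E).
  apply: eq_integrable (integrableB mK iv im) => // x _.
  by rewrite /= -EFinB mulrBl.
rewrite p1 e1 e2 normrN EFin_normr_Rintegral//.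
apply: le_trans (le_abse_integral _ _ _) _ => //; first exact: measurable_int ivm.
have mvm : measurable_fun K (fun x => (`|v x - m|)%:E).
  apply/measurable_EFinP; apply: measurableT_comp => //.
  by apply: measurable_funB => //; exact: Lfun_on_measurable lv.
have B0 : 0 <= B / rho ^+ 2.
  by rewrite divr_ge0 ?exprn_ge0 ?(ltW rho0)// (le_trans (normr_ge0 _) (HB 0)).
rewrite -ge0_integralZl//; apply: ge0_le_integral => //.
- by apply: measurableT_comp => //; exact: measurable_int ivm.
- exact: measurable_funeM.
- move=> x Kx; rewrite -EFinM lee_fin normrM mulrC ler_wpM2r//.
  exact: cutoff2_bound.
Qed.

End spatial_integration_by_parts.

(** * The logarithm of the solution on time slices *)

Section log_diffusion_slices.
Context {R : realType} {N : nat}.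
Local Notation leb := (@lebesgue_measure R).
Local Notation lebN := (@lebesgue_measure_rV R N).
Local Notation lebNT := (lebN \x leb)%E.

Lemma Rintegral_sum_ord d (T : measurableType d) (mu : {measure set T -> \bar R})
    (D : set T) (n : nat) (f : 'I_n -> T -> R) : measurable D ->
  (forall i, mu.-integrable D (EFin \o f i)) ->
  \int[mu]_(x in D) (\sum_(i < n) f i x) = \sum_(i < n) \int[mu]_(x in D) f i x.
Proof.
move=> mD fi; rewrite /Rintegral.
under eq_integral do rewrite -sumEFin.
rewrite (integral_sum mD fi).
by rewrite sum_fine// => i _; apply: integrable_fin_num => //; exact: fi.
Qed.

Lemma lebesgue_cylinder_gt0 (y : 'rV[R]_N) (r s t : R) : 0 < r -> s < t ->
  (0 < lebNT (cube y r `*` `]s, t]))%E.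
Proof.
move=> r0 st; rewrite product_measure1E//; last exact: measurable_cube.
rewrite [X in (_ < X * _)%E]lebesgue_cube//.
rewrite [X in (_ < _ * X)%E](@lebesgue_measure_itv R `]s, t])/=.
rewrite lte_fin st -EFinD -EFinM lte_fin.
by rewrite mulr_gt0 ?exprn_gt0// subr_gt0.
Qed.

(** Otherwise [u <= 0] almost everywhere on a cylinder of positive measure, against [u > 0] almost
    everywhere. Positivity of [M] is what permits splitting [ln (u / M)]. *)
Lemma cyl_sup_gt0 (E : set 'rV[R]_N) (T : R) (u : 'rV[R]_N -> R -> R)
    (y : 'rV[R]_N) (rho s t : R) : 0 < rho -> s < t ->
  cube y (2 * rho) `*` `[s, t] `<=` E `*` `]0, T] ->
  {ae lebNT, forall z, E z.1 -> 0 < z.2 <= T -> 0 < u z.1 z.2} ->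
  (cyl_sup u y rho s t < +oo)%E -> 0 < fine (cyl_sup u y rho s t).
Proof.
move=> rho0 st sub u0 supoo; rewrite ltNge; apply/negP => M0.
(* [fine] maps both infinities to 0; [+oo] is excluded by [supoo], and [-oo] satisfies the bound. *)
have sup0 : (cyl_sup u y rho s t <= 0)%E.
  by move: M0 supoo; case: (cyl_sup _ _ _ _ _) => //= r; rewrite lee_fin.
pose C : set ('rV[R]_N * measurableTypeR R) := cube y (2 * rho) `*` `]s, t].
have mC : measurable C by apply: measurableX => //; exact: measurable_cube.
have [A [mA A0 CA]] : {ae lebNT, forall z, ~ C z}.
  have FF := @ae_filter_ringOfSetsType _ _ R lebNT.
  have usup := ess_sup_ge lebNT (patch (fun=> -oo%E) C (fun z => (u z.1 z.2)%:E)).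
  apply: (@filterS2 _ _ FF _ _ _ _ u0 usup) => z uz0 uz Cz.
  move: (Cz) => [Cz1 /=]; rewrite in_itv/= => /andP[sz2 z2t].
  have [Ez] : (E `*` `]0, T]) z.
    by apply: sub; split => //=; rewrite in_itv/= (ltW sz2).
  rewrite /= in_itv/= => zT.
  have := uz0 Ez zT; rewrite ltNge => /negP; apply.
  by move: (le_trans uz sup0); rewrite /patch mem_set.
have : (0 < lebNT C)%E by apply: lebesgue_cylinder_gt0 => //; rewrite mulr_gt0.
rewrite (subset_measure0 mC mA _ A0) ?ltxx// => z Cz.
by apply: CA => /= /(_ Cz).
Qed.

Lemma cube_sub_domain (E : set 'rV[R]_N) (T : R) (y : 'rV[R]_N) (rho s t : R) :
  s < t -> cube y (2 * rho) `*` `[s, t] `<=` E `*` `]0, T] ->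
  cube y (2 * rho) `<=` E.
Proof.
move=> st sub x Qx; have [] // : (E `*` `]0, T]) (x, s).
by apply: sub; split => //=; rewrite in_itv/= lexx ltW.
Qed.

Lemma ae_integral_log_le_Lambda (u : 'rV[R]_N -> R -> R) (y : 'rV[R]_N)
    (rho s t : R) (Q := cube y (2 * rho)) (M := fine (cyl_sup u y rho s t)) :
  0 < rho -> (Lambda 1 u y rho s t < +oo)%E ->
  {ae leb, forall tau, s <= tau <= t ->
    (\int[lebN]_(x in Q) (`|ln (u x tau / M)|)%:E <=
     (fine (Lambda 1 u y rho s t) * (2 * rho) ^+ N)%:E)%E}.
Proof.
move=> rho0 Lambdaoo.
have := @ess_sup_ge _ _ R leb (patch (fun=> -oo%E) `[s, t]%classic (fun tau =>
  (((fine (lebN Q))^-1)%:E *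
     \int[lebN]_(x in Q) (`|ln (u x tau / M)| ^+ 1)%:E) `^ (1%:R^-1))%E).
apply: filterS => tau; rewrite -/(ess_sup_on _ _ _) -/(Lambda 1 u y rho s t).
rewrite /patch => h /andP[stau taut]; move: h.
rewrite mem_set/= ?in_itv/= ?stau// invr1.
have rN : 0 < (2 * rho) ^+ N by rewrite exprn_gt0// mulr_gt0.
have I0 : (0 <= \int[lebN]_(x in Q) (`|ln (u x tau / M)|)%:E)%E.
  by apply: integral_ge0 => x _; rewrite lee_fin.
have V0 : (0 <= ((fine (lebN Q))^-1)%:E *
    \int[lebN]_(x in Q) (`|ln (u x tau / M)|)%:E)%E.
  by rewrite mule_ge0// lee_fin invr_ge0 fine_ge0.
under eq_integral do rewrite expr1.
rewrite poweRe1//; move: V0.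
have -> : lebN Q = ((2 * rho) ^+ N)%:E.
  by apply: lebesgue_cube; rewrite mulr_gt0.
move: Lambdaoo; rewrite /=; case: (Lambda _ _ _ _ _ _) => [l||]//= _ V0.
  by rewrite lee_pdivrMl// EFinM muleC.
(* The value [-oo] of [Lambda] is impossible, as it would bound a nonnegative average. *)
by move=> /(le_trans V0).
Qed.

End log_diffusion_slices.

Section log_diffusion_mass_change.
Context {R : realType} {N : nat}.
Local Notation leb := (@lebesgue_measure R).
Local Notation lebN := (@lebesgue_measure_rV R N).
Local Notation lebNT := (lebN \x leb)%E.

Variables (E : set 'rV[R]_N) (T : R) (u : 'rV[R]_N -> R -> R)
  (y : 'rV[R]_N) (rho s t : R).
Hypotheses (rho0 : 0 < rho) (s0 : 0 < s) (st : s < t) (tT : t <= T).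
Hypothesis sub : cube y (2 * rho) `*` `[s, t] `<=` E `*` `]0, T].
Hypothesis supoo : (cyl_sup u y rho s t < +oo)%E.
Hypothesis Lambdaoo : (Lambda 1 u y rho s t < +oo)%E.

Let Q := cube y (2 * rho).
Let K := cbox y (3 / 4 * rho).
Let M := fine (cyl_sup u y rho s t).
Let L := fine (Lambda 1 u y rho s t).
Let zeta := cutoff y rho (fun=> 0%N).

Lemma cbox_sub_domain : K `<=` E.
Proof.
move=> x Kx; apply: (cube_sub_domain st sub).
by apply: cbox_sub_double_cube Kx.
Qed.

Lemma ae_slice_bound (Dlnu : 'I_N -> 'rV[R]_N -> R -> R) (B : R) :
  {ae lebNT, forall z, E z.1 -> 0 < z.2 <= T -> 0 < u z.1 z.2} ->
  C_L2 T K u ->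
  {ae leb, forall tau, 0 < tau <= T ->
    W12_loc E (fun x => ln (u x tau)) (fun i => Dlnu i ^~ tau)} ->
  (forall z : R, `|derive1n 2 bump z| <= B) ->
  {ae leb, forall tau, s <= tau <= t ->
    `|\int[lebN]_(x in K) (- (u x tau * 0) +
        \sum_(i < N) Dlnu i x tau * partial i zeta x)| <=
    N%:R * (B / rho ^+ 2 * (`|L| * (2 * rho) ^+ N))}.
Proof.
move=> u0 Cu WD HB.
have mK : measurable K by exact: measurable_cbox.
have Koo : (lebN K < +oo)%E by exact: lebesgue_cbox_lty.
have KE := cbox_sub_domain.
have M0 : 0 < M by apply: (cyl_sup_gt0 rho0 st sub).
have FF := @ae_filter_ringOfSetsType _ _ R leb.
have u0' := ae_ysection u0.
have LQ := ae_integral_log_le_Lambda rho0 Lambdaoo.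
apply: (@filterS3 _ _ FF _ _ _ _ _ u0' WD LQ) => tau utau Wtau Ltau staut.
have tauT : 0 < tau <= T.
  by case/andP: staut => s1 s2; rewrite (lt_le_trans s0 s1) (le_trans s2 tT).
have {}Wtau := Wtau tauT; have {}Ltau := Ltau staut.
have mu : measurable_fun K (u ^~ tau).
  by have [lu _] := Cu _ tauT; exact: (Lfun_on_measurable mK lu).
(* The logarithm of the quotient splits only where [u > 0], that is, for almost every [x] in almost
   every slice. *)
have eK : (\int[lebN]_(x in K) (`|ln (u x tau) - ln M|)%:E =
    \int[lebN]_(x in K) (`|ln (u x tau / M)|)%:E)%E.
  apply: ge0_ae_eq_integral => //.
  - apply/measurable_EFinP; apply: measurableT_comp => //.
    by apply: measurable_funB => //; exact: measurableT_comp.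
  - apply/measurable_EFinP; apply: measurableT_comp => //.
    by apply: measurableT_comp => //; exact: measurable_funM.
  - have FN := @ae_filter_ringOfSetsType _ _ R lebN.
    apply: (@filterS _ _ FN _ _ _ utau) => x /= ux Kx.
    by rewrite ln_div// posrE; exact: (ux (KE _ Kx)).
have rN : 0 <= (2 * rho) ^+ N by rewrite exprn_ge0// mulr_ge0// ltW.
have Kle : (\int[lebN]_(x in K) (`|ln (u x tau) - ln M|)%:E <=
    (`|L| * (2 * rho) ^+ N)%:E)%E.
  apply: (@le_trans _ _ (L * (2 * rho) ^+ N)%:E).
    rewrite eK; apply: le_trans Ltau; apply: ge0_le_integral_nomeas.
    - exact: cbox_sub_double_cube.
    - by move=> x _; rewrite lee_fin.
    - by move=> x _; rewrite lee_fin normr_ge0 lexx.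
  by rewrite lee_fin ler_wpM2r// ler_norm.
have B0 : 0 <= B / rho ^+ 2.
  by rewrite divr_ge0 ?exprn_ge0 ?(ltW rho0)// (le_trans (normr_ge0 _) (HB 0)).
have bound i : `|\int[lebN]_(x in K) (Dlnu i x tau * partial i zeta x)| <=
    B / rho ^+ 2 * (`|L| * (2 * rho) ^+ N).
  rewrite -lee_fin.
  apply: le_trans (weak_gradient_cutoff_bound (ln M) i rho0 KE Wtau HB) _.
  by rewrite [leRHS]EFinM lee_wpmul2l// lee_fin.
have [_ lD] := Wtau.1 K (@compact_cbox _ _ _ _) KE.
have iD i : lebN.-integrable K (EFin \o (fun x => Dlnu i x tau * partial i zeta x)).
  apply: (Lfun_on_integrableM mK (lD i)).
  rewrite /zeta partial_cutoff; have [C HC] := cutoff_bounded y rho0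
    (fun j => (0 + (j == i))%N).
  apply: (Lfun_on_bounded (B := C)) => //.
  by apply: measurable_funTS; exact: measurable_cutoff.
under eq_Rintegral do rewrite mulr0 oppr0 add0r.
rewrite Rintegral_sum_ord// (le_trans (ler_norm_sum _ _ _))//.
rewrite (le_trans (ler_sum _ (fun i _ => bound i)))//.
by rewrite sumr_const card_ord [leRHS]mulr_natl.
Qed.

Lemma mass_change_bound (B tau1 tau2 : R) : 0 < T ->
  log_diffusion_solution T E u ->
  (forall z : R, `|derive1n 2 bump z| <= B) ->
  s < tau1 -> tau1 <= tau2 -> tau2 < t ->
  `|\int[lebN]_(x in K) (u x tau2 * zeta x) -
    \int[lebN]_(x in K) (u x tau1 * zeta x)| <=
  N%:R * (B / rho ^+ 2 * (`|L| * (2 * rho) ^+ N)) * (t - s).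
Proof.
move=> T0 [_ u0 _ Cu [Dlnu [[_ WD] weq]]] HB stau1 tau12 tau2t.
have mK : measurable K by exact: measurable_cbox.
have cK : compact K by exact: compact_cbox.
have Koo : (lebN K < +oo)%E by exact: lebesgue_cbox_lty.
have KE := cbox_sub_domain.
have mz : measurable_fun setT zeta by exact: measurable_cutoff.
have z1 x : `|zeta x| <= 1.
  by rewrite ger0_norm ?cutoff0_ge0 ?cutoff0_le1.
have zK : Cc_infty K° zeta.
  apply: cutoff_Cc_infty => //; apply: cbox_interior.
  by rewrite ltr_pM2r//; lra.
have W1 := W12loc_L2_cst T0 mK Koo mz z1.
have mDz i : measurable_fun setT (partial i zeta).
  by rewrite partial_cutoff; exact: measurable_cutoff.
have Dzb i : exists B', forall x, `|partial i zeta x| <= B'.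
  by rewrite partial_cutoff; exact: cutoff_bounded.
have W2 : L2loc_W12_0 T K (fun x _ => zeta x) (fun i x _ => partial i zeta x).
  split.
  - exact: (L2loc_L2_cst mK Koo mz z1).
  - by move=> i; have [B' HB'] := Dzb i; exact: (L2loc_L2_cst mK Koo (mDz i) HB').
  - by apply: aeW => tau _; exact: (W12_0_Cc_infty mK Koo zK mz z1 mDz Dzb).
have tau10 : 0 < tau1 by exact: lt_trans stau1.
have tau2T : tau2 <= T by rewrite (le_trans (ltW tau2t)).
have := weq K tau1 tau2 _ _ _ cK KE tau10 tau12 tau2T W1 W2.
move=> /eqP; rewrite addr_eq0 => /eqP ->; rewrite normrN.
set c := N%:R * _.
have B0 : 0 <= B by rewrite (le_trans (normr_ge0 _) (HB 0)).
have c0 : 0 <= c.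
  have r0 := ltW rho0.
  by rewrite mulr_ge0// mulr_ge0 ?divr_ge0 ?exprn_ge0// mulr_ge0 ?exprn_ge0// mulr_ge0.
have lebI : leb `[tau1, tau2]%classic = (tau2 - tau1)%:E.
  rewrite [LHS](@lebesgue_measure_itv R `[tau1, tau2])/= lte_fin.
  move: tau12; rewrite le_eqVlt => /predU1P[->|->]; last by rewrite -EFinD.
  by rewrite ltxx subrr.
have lebI_lty : (leb `[tau1, tau2]%classic < +oo)%E by rewrite lebI ltry.
apply: le_trans (@normr_Rintegral_le_cst _ _ R leb _ _ c _ lebI_lty c0 _) _ => //.
  have FF := @ae_filter_ringOfSetsType _ _ R leb.
  apply: (@filterS _ _ FF _ _ _ (ae_slice_bound u0 (Cu K cK KE) WD HB)) => tau h.
  rewrite /= in_itv/= => /andP[t1 t2]; apply: h.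
  by rewrite (le_trans (ltW stau1) t1) (le_trans t2 (ltW tau2t)).
by rewrite ler_wpM2l// [leLHS](congr1 fine lebI)/= lerB// ltW.
Qed.

End log_diffusion_mass_change.

(** * Comparing the masses at two times *)

Section mass_comparison.
Context {R : realType} {N : nat}.
Local Notation lebN := (@lebesgue_measure_rV R N).

Variables (E : set 'rV[R]_N) (T : R) (u : 'rV[R]_N -> R -> R)
  (y : 'rV[R]_N) (rho s t : R).
Hypotheses (rho0 : 0 < rho) (s0 : 0 < s) (st : s < t) (tT : t <= T).
Hypothesis sub : cube y (2 * rho) `*` `[s, t] `<=` E `*` `]0, T].
Hypothesis supoo : (cyl_sup u y rho s t < +oo)%E.
Hypothesis Lambdaoo : (Lambda 1 u y rho s t < +oo)%E.
Hypothesis solu : log_diffusion_solution T E u.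

Let K := cbox y (3 / 4 * rho).
Let L := fine (Lambda 1 u y rho s t).
Let zeta := cutoff y rho (fun=> 0%N).
Let A tau := \int[lebN]_(x in K) (u x tau * zeta x).

(** Both factors are in [L^2(K)], so the integral is finite and [A tau] is not a default value of
    [fine]. *)
Lemma cutoff_mass_fin tau : 0 < tau <= T ->
  (A tau)%:E = (\int[lebN]_(x in K) (u x tau * zeta x)%:E)%E.
Proof.
move=> tauT; case: solu => _ _ _ Cu _.
have mK : measurable K by exact: measurable_cbox.
have [lu _] := Cu K (@compact_cbox _ _ _ _) (cbox_sub_domain rho0 st sub) _ tauT.
have lz : Lfun_on lebN K 2 zeta.
  apply: (Lfun_on_bounded (B := 1)) => //.
  - exact: lebesgue_cbox_lty.
  - by apply: measurable_funTS; exact: measurable_cutoff.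
  - by move=> x _; rewrite ger0_norm ?cutoff0_ge0 ?cutoff0_le1.
by rewrite fineK// integrable_fin_num//; exact: Lfun_on_integrableM.
Qed.

Lemma cutoff_mass_le tau : 0 < tau <= T ->
  ((A tau)%:E <= \int[lebN]_(x in cube y (2 * rho)) (u x tau)%:E)%E.
Proof.
move=> tauT; case: (solu) => u0 _ _ _ _; rewrite cutoff_mass_fin//.
have KQ : K `<=` cube y (2 * rho) by exact: cbox_sub_double_cube.
have QE := cube_sub_domain st sub.
apply: ge0_le_integral_nomeas => // [x /QE Ex|x /KQ/QE Ex].
  by rewrite lee_fin u0.
by rewrite !lee_fin mulr_ge0 ?u0 ?cutoff0_ge0// ler_piMr ?u0 ?cutoff0_le1.
Qed.

Lemma le_cutoff_mass (c tau : R) : 0 < c ->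
  (forall z : R, `|z| < 2^-1 -> c <= bump z) -> 0 < tau <= T ->
  (\int[lebN]_(x in cube y rho) (u x tau)%:E <= (A tau / c ^+ N)%:E)%E.
Proof.
move=> c0 hc tauT; case: (solu) => u0 _ _ Cu _.
have cN : 0 < c ^+ N by rewrite exprn_gt0.
have KE := cbox_sub_domain rho0 st sub.
have mK : measurable K by exact: measurable_cbox.
have [lu _] := Cu K (@compact_cbox _ _ _ _) KE _ tauT.
have CK : cube y rho `<=` K by exact: cube_sub_cbox34.
rewrite mulrC EFinM cutoff_mass_fin// -ge0_integralZl//; first last.
- by rewrite lee_fin invr_ge0 ltW.
- by move=> x /KE Ex; rewrite lee_fin mulr_ge0 ?u0 ?cutoff0_ge0.
- apply/measurable_EFinP; apply: measurable_funM.
    exact: (Lfun_on_measurable mK lu).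
  by apply: measurable_funTS; exact: measurable_cutoff.
apply: ge0_le_integral_nomeas => // x.
  move=> /KE Ex; rewrite -EFinM lee_fin mulr_ge0 ?invr_ge0 ?(ltW cN)//.
  by rewrite mulr_ge0 ?u0 ?cutoff0_ge0.
move=> Cx; have Ex := KE _ (CK _ Cx); rewrite -EFinM !lee_fin u0//=.
rewrite mulrC ler_pdivlMr// ler_wpM2l ?u0//.
exact: cutoff0_ge.
Qed.

Lemma mass_comparison (c B tau1 tau2 : R) : 0 < T -> 0 < c ->
  (forall z : R, `|z| < 2^-1 -> c <= bump z) ->
  (forall z : R, `|derive1n 2 bump z| <= B) ->
  s < tau1 < t -> s < tau2 < t ->
  (\int[lebN]_(x in cube y rho) (u x tau1)%:E <=
   ((1 + N%:R * B * 2 ^+ N * `|L|) / c ^+ N)%:E *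
   (\int[lebN]_(x in cube y (2 * rho)) (u x tau2)%:E +
    ((t - s) / rho `^ (2 - N%:R))%:E))%E.
Proof.
move=> T0 c0 hc HB /andP[s1 t1] /andP[s2 t2].
have tau1T : 0 < tau1 <= T by rewrite (lt_trans s0 s1) (le_trans (ltW t1) tT).
have tau2T : 0 < tau2 <= T by rewrite (lt_trans s0 s2) (le_trans (ltW t2) tT).
have cN : 0 < c ^+ N by rewrite exprn_gt0.
have B0 : 0 <= B by rewrite (le_trans (normr_ge0 _) (HB 0)).
set d := (t - s) / _.
set C := N%:R * B * 2 ^+ N * `|L|.
have C0 : 0 <= C by rewrite !mulr_ge0// exprn_ge0.
have d0 : 0 < d by rewrite divr_gt0 ?subr_gt0 ?powR_gt0.
(* The scaling: [rho^-2 * (2 rho)^N = 2^N / rho^(2 - N)]. *)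
have dE : N%:R * (B / rho ^+ 2 * (`|L| * (2 * rho) ^+ N)) * (t - s) = C * d.
  rewrite /C /d powRB; last by apply/implyP => _; rewrite gt_eqF.
  rewrite !powR_mulrn ?ltW// exprMn; field.
  by rewrite expf_neq0 gt_eqF.
have AA : A tau1 <= A tau2 + C * d.
  have H a b := @mass_change_bound _ _ _ _ _ _ _ _ _ rho0 s0 st tT sub supoo
    Lambdaoo B a b T0 solu HB.
  have [t12|t21] := leP tau1 tau2.
    by have := H _ _ s1 t12 t2; rewrite dE ler_distl => /andP[h _]; rewrite -lerBlDr.
  by have := H _ _ s2 (ltW t21) t1; rewrite dE ler_distl => /andP[_ h].
apply: (le_trans (le_cutoff_mass c0 hc tau1T)).
(* The mass in the large cube may be infinite, as its closure need not lie in [E]; then the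
   right-hand side is [+oo]. *)
have := cutoff_mass_le tau2T; case: (integral _ _ _) => [J||//]; last first.
  by move=> _; rewrite addye// gt0_muley ?leey// lte_fin divr_gt0// ltr_pwDl.
rewrite lee_fin => AJ; rewrite -EFinD -EFinM lee_fin mulrAC ler_pM2r ?invr_gt0//.
have A0 : 0 <= A tau2.
  case: (solu) => u0 _ _ _ _; apply: Rintegral_ge0 => x.
  by move=> /(cbox_sub_domain rho0 st sub) Ex; rewrite mulr_ge0 ?u0 ?cutoff0_ge0.
(* [A tau2 + C d <= (1 + C) (J + d)], from [0 <= A tau2 <= J] and the signs of [C] and [d]. *)
apply: le_trans AA _; nra.
Qed.

End mass_comparison.

Theorem proposition2p1 (R : realType) (N : nat) (r p : R) (hN : (0 < N)%N)
    (hr : Num.max 1 (N%:R / 2) < r) (hp : 2 <= p) :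
  exists gamma : R -> R -> R, (forall l1 l2, 0 < gamma l1 l2) /\
  forall (E : set 'rV[R]_N) (T : R) (u : 'rV[R]_N -> R -> R),
    open E -> 0 < T ->
    log_diffusion_solution T E u ->
    Lrloc T E r u ->
    Linfloc_Lploc T E p (fun x t => ln (u x t)) ->
    forall (y : 'rV[R]_N) (rho s t : R),
      0 < rho -> 0 < s -> s < t -> t <= T ->
      cube y (2 * rho) `*` `[s, t] `<=` E `*` `]0, T] ->
      (cyl_sup u y rho s t < +oo)%E ->
      (Lambda 1 u y rho s t < +oo)%E ->
      (Lambda 2 u y rho s t < +oo)%E ->
      (ereal_sup [set \int[lebesgue_measure_rV N]_(x in cube y rho)
                        (u x tau)%:E | tau in `]s, t[]
       <= (gamma (fine (Lambda 1 u y rho s t))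
                 (fine (Lambda 2 u y rho s t)))%:E *
          (ereal_inf [set \int[lebesgue_measure_rV N]_(x in cube y (2 * rho))
                            (u x tau)%:E | tau in `]s, t[]
           + ((t - s) / rho `^ (2 - N%:R))%:E))%E.
Proof.
have [c c0 hc] := @bump_lb R.
have [B B0 HB] := @bump_derive_bounded R 2.
have gamma0 (l : R) : 0 < (1 + N%:R * B * 2 ^+ N * `|l|) / c ^+ N.
  by rewrite divr_gt0 ?exprn_gt0// ltr_pwDl// !mulr_ge0// exprn_ge0.
(* The absolute value makes [gamma] positive at every real argument. *)
exists (fun l1 _ => (1 + N%:R * B * 2 ^+ N * `|l1|) / c ^+ N); split=> //.
move=> E T u _ T0 solu _ _ y rho s t rho0 s0 st tT sub supoo L1oo _.
have {}gamma0 := gamma0 (fine (Lambda 1 u y rho s t)).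
set gamma := (_ / c ^+ N) in gamma0 *.
set d := (t - s) / _.
apply: ge_ereal_sup => _ [tau1 /= + <-]; rewrite in_itv/= => tau1st.
have comp tau2 : s < tau2 < t -> _ := mass_comparison rho0 s0 st tT sub supoo
  L1oo solu T0 c0 hc HB tau1st (tau2 := tau2).
(* Since [gamma] is positive and [d] is real, both move to the left, and the infimum is then bounded
   below term by term. *)
rewrite -lee_pdivrMl// -leeBlDr//; apply: le_ereal_inf_tmp => _ [tau2 /= + <-].
rewrite in_itv/= => /comp; rewrite -lee_pdivrMl//.
by rewrite -leeBlDr.
Qed.
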